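(* Let $(S,\mathfrak n)$ be a commutative noetherian local ring and let $\omega\in\mathfrak n$ be a non-zerodivisor. Then there is a triangle equivalence functor $\underline{\mathsf{Mon}}(\omega,\mathcal G)\longrightarrow\underline{\mathsf{MF}}(\omega,\mathcal G)$.
   Context: All modules are finitely generated. A finitely generated $S$-module $M$ is Gorenstein projective if $\mathrm{Ext}^i_S(M,S)=0=\mathrm{Ext}^i_S(\mathrm{Hom}_S(M,S),S)$ for all $i\ge 1$ and the biduality map $M\to \mathrm{Hom}_S(\mathrm{Hom}_S(M,S),S)$ is an isomorphism; $\mathcal G(S)$ is the category of finitely generated Gorenstein projective $S$-modules. $\mathsf{Mon}(\omega,\mathcal G)$ is the category whose objects are the injective $S$-homomorphisms $(G_1\xrightarrow{f}G_0)$ with $G_1,G_0\in\mathcal G(S)$ and $\omega\,\mathrm{Coker} f=0$; morphisms $(G_1\xrightarrow{f}G_0)\to(G'_1\xrightarrow{f'}G'_0)$ are pairs $(\varphi_1,\varphi_0)$ of $S$-homomorphisms $\varphi_i:G_i\to G_i'$ with $f'\varphi_1=\varphi_0 f$. $\mathsf{MF}(\omega,\mathcal G)$ is the category whose objects are ordered pairs of $S$-homomorphisms $(G_1\xrightarrow{g_1}G_0,\ G_0\xrightarrow{g_0}G_1)$ with $G_1,G_0\in\mathcal G(S)$, $g_1g_0=\omega\cdot\mathrm{id}_{G_0}$ and $g_0g_1=\omega\cdot\mathrm{id}_{G_1}$; morphisms $(g_1,g_0)\to(g_1',g_0')$ are pairs of $S$-homomorphisms $\phi_1:G_1\to G_1'$,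 $\phi_0:G_0\to G_0'$ with $g_1'\phi_1=\phi_0g_1$ and $g_0'\phi_0=\phi_1g_0$. Both are exact categories with the componentwise short exact sequences (with all terms in the category) as conflations, and both are Frobenius categories (enough projectives and injectives, which coincide). The stable category $\underline{\mathcal F}$ of a Frobenius category $\mathcal F$ has the same objects, with morphisms taken modulo those factoring through projective objects; it carries Happel's triangulated structure, with shift the inverse syzygy and distinguished triangles induced by conflations. A triangle functor is an additive functor commuting with shifts up to natural isomorphism and preserving distinguished triangles; a triangle equivalence is a triangle functor that is an equivalence. *)

(* Defs.v *)
From HB Require Import structures.
From mathcomp Require Import all_boot all_algebra all_classical.

Set Implicit Arguments.
Unset Strict Implicit.
Unset Printing Implicit Defensive.

Import GRing.Theory.
Local Open Scope ring_scope.

Section Rings.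
Variable S : comNzRingType.

Definition is_ideal (I : set S) : Prop :=
  [/\ I 0, forall x y, I x -> I y -> I (x + y)
    & forall a x, I x -> I (a * x)].

Definition noetherian : Prop :=
  forall I : set S, is_ideal I ->
    exists k (g : 'I_k -> S),
      forall x, I x <-> exists a : 'I_k -> S, x = \sum_(i < k) a i * g i.

Definition maximal_ideal (m : set S) : Prop :=
  [/\ is_ideal m, ~ m 1
    & forall J : set S, is_ideal J -> ~ J 1 -> (m `<=` J)%classic -> J = m].

Definition local_with (n : set S) : Prop :=
  maximal_ideal n /\ forall m : set S, maximal_ideal m -> m = n.

End Rings.

Section HomModule.
Variables (S : comNzRingType) (M N : lmodType S).
Implicit Types f g h : {linear M -> N}.

Lemma linear_ext f g : f =1 g -> f = g.
Proof.
case: f g => f [[fA] [fZ]] [g [[gA] [gZ]]] /= /funext efg.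
rewrite efg in fA fZ *.
by rewrite (Prop_irrelevance fA gA) (Prop_irrelevance fZ gZ).
Qed.

HB.instance Definition _ := gen_eqMixin {linear M -> N}.
HB.instance Definition _ := gen_choiceMixin {linear M -> N}.

Definition lin_zero : {linear M -> N} := \0.
Definition lin_opp f : {linear M -> N} := \- f.
Definition lin_add f g : {linear M -> N} := f \+ g.
Definition lin_scale (a : S) f : {linear M -> N} := a \*: f.

Lemma lin_addA : associative lin_add.
Proof. by move=> f g h; apply: linear_ext => x /=; rewrite addrA. Qed.
Lemma lin_addC : commutative lin_add.
Proof. by move=> f g; apply: linear_ext => x /=; rewrite addrC. Qed.
Lemma lin_add0 : left_id lin_zero lin_add.
Proof. by move=> f; apply: linear_ext => x /=; rewrite add0r. Qed.
Lemma lin_addN : left_inverse lin_zero lin_opp lin_add.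
Proof. by move=> f; apply: linear_ext => x /=; rewrite addNr. Qed.

HB.instance Definition _ := GRing.isZmodule.Build {linear M -> N}
  lin_addA lin_addC lin_add0 lin_addN.

Lemma lin_scaleA a b f : lin_scale a (lin_scale b f) = lin_scale (a * b) f.
Proof. by apply: linear_ext => x /=; rewrite scalerA. Qed.
Lemma lin_scale1 : left_id 1 lin_scale.
Proof. by move=> f; apply: linear_ext => x /=; rewrite scale1r. Qed.
Lemma lin_scaleDr : right_distributive lin_scale +%R.
Proof. by move=> a f g; apply: linear_ext => x /=; rewrite scalerDr. Qed.
Lemma lin_scaleDl f : {morph lin_scale^~ f : a b / a + b}.
Proof. by move=> a b; apply: linear_ext => x /=; rewrite scalerDl. Qed.

HB.instance Definition _ := GRing.Zmodule_isLmodule.Build S {linear M -> N}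
  lin_scaleA lin_scale1 lin_scaleDr lin_scaleDl.

End HomModule.

Section Modules.
Variable S : comNzRingType.
Implicit Types M N : lmodType S.

Definition finitely_generated M : Prop :=
  exists k (g : 'I_k -> M),
    forall x, exists a : 'I_k -> S, x = \sum_(i < k) a i *: g i.

Definition dual M : lmodType S := {linear M -> S^o}.

Section Biduality.
Variables (M : lmodType S) (x : M).
Definition evaluation (phi : dual M) : S^o := (phi : {linear M -> S^o}) x.
Fact evaluation_is_linear : linear evaluation.
Proof. by []. Qed.
HB.instance Definition _ :=
  GRing.isLinear.Build S (dual M) S^o _ evaluation evaluation_is_linear.
Definition biduality : dual (dual M) := (evaluation : {linear _ -> _}).
End Biduality.

Definition projective_module (P : lmodType S) : Prop :=
  forall (A B : lmodType S) (p : {linear A -> B}) (g : {linear P -> B}),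
    (forall b, exists a, p a = b) ->
    exists h : {linear P -> A}, forall x, p (h x) = g x.

Record projective_resolution M := ProjectiveResolution {
  res_obj : nat -> lmodType S;
  res_diff : forall i, {linear res_obj i.+1 -> res_obj i};
  res_aug : {linear res_obj 0%N -> M};
  res_proj : forall i, projective_module (res_obj i);
  res_aug_surj : forall x, exists y, res_aug y = x;
  res_exact0 : forall y, res_aug y = 0 <-> exists z, res_diff 0%N z = y;
  res_exact : forall i y,
    res_diff i y = 0 <-> exists z, res_diff i.+1 z = y }.

Section Ext.
Variables (M N : lmodType S) (P : projective_resolution M).

Definition ext_cocycle i (c : {linear res_obj P i -> N}) : Prop :=
  forall z, c (res_diff P i z) = 0.

Definition ext_coboundary i : {linear res_obj P i -> N} -> Prop :=
  match i return {linear res_obj P i -> N} -> Prop with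
  | 0%N => fun c => c = 0
  | j.+1 => fun c =>
      exists b : {linear res_obj P j -> N}, forall y, c y = b (res_diff P j y)
  end.

End Ext.

(* Ext^i_S(M, N) = 0, computed from a projective resolution of M; whether it
   holds does not depend on the resolution. *)
Definition Ext_zero (i : nat) M N : Prop :=
  exists P : projective_resolution M,
    forall c : {linear res_obj P i -> N}, ext_cocycle c -> ext_coboundary c.

Record gorenstein_projective M : Prop := GorensteinProjective {
  gp_fg : finitely_generated M;
  gp_ext : forall i, (1 <= i)%N -> Ext_zero i M S^o;
  gp_ext_dual : forall i, (1 <= i)%N -> Ext_zero i (dual M) S^o;
  gp_bidual : bijective (@biduality M) }.

Definition short_exact (A B C : lmodType S)
    (i : {linear A -> B}) (p : {linear B -> C}) : Prop :=
  [/\ injective i, forall y, p y = 0 <-> exists x, i x = y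
    & forall z, exists y, p y = z].

End Modules.

Record preadditive := Preadditive {
  ob :> Type;
  hom : ob -> ob -> zmodType;
  idm : forall X, hom X X;
  comp : forall X Y Z, hom Y Z -> hom X Y -> hom X Z;
  compA : forall X Y Z W (h : hom Z W) (g : hom Y Z) (f : hom X Y),
    comp h (comp g f) = comp (comp h g) f;
  comp1m : forall X Y (f : hom X Y), comp (idm Y) f = f;
  compm1 : forall X Y (f : hom X Y), comp f (idm X) = f;
  compDm : forall X Y Z (g g' : hom Y Z) (f : hom X Y),
    comp (g + g') f = comp g f + comp g' f;
  compmD : forall X Y Z (g : hom Y Z) (f f' : hom X Y),
    comp g (f + f') = comp g f + comp g f' }.

Arguments idm {p} X.
Notation "g \oc f" := (comp g f) (at level 40, left associativity).

Section Preadditive.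
Variable C : preadditive.

Lemma comp0m (X Y Z : C) (f : hom X Y) : (0 : hom Y Z) \oc f = 0.
Proof. by apply: (addIr (0 \oc f)); rewrite -compDm !add0r. Qed.
Lemma compm0 (X Y Z : C) (g : hom Y Z) : g \oc (0 : hom X Y) = 0.
Proof. by apply: (addIr (g \oc 0)); rewrite -compmD !add0r. Qed.
Lemma compNm (X Y Z : C) (g : hom Y Z) (f : hom X Y) :
  (- g) \oc f = - (g \oc f).
Proof. by apply: (addIr (g \oc f)); rewrite -compDm !addNr comp0m. Qed.
Lemma compmN (X Y Z : C) (g : hom Y Z) (f : hom X Y) :
  g \oc (- f) = - (g \oc f).
Proof. by apply: (addIr (g \oc f)); rewrite -compmD !addNr compm0. Qed.
Lemma compBm (X Y Z : C) (g g' : hom Y Z) (f : hom X Y) :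
  (g - g') \oc f = g \oc f - g' \oc f.
Proof. by rewrite compDm compNm. Qed.
Lemma compmB (X Y Z : C) (g : hom Y Z) (f f' : hom X Y) :
  g \oc (f - f') = g \oc f - g \oc f'.
Proof. by rewrite compmD compmN. Qed.

Definition is_iso (X Y : C) (f : hom X Y) : Prop :=
  exists g : hom Y X, g \oc f = idm X /\ f \oc g = idm Y.

Definition has_zero_object : Prop := exists Z : C, idm Z = 0.

Definition has_biproducts : Prop :=
  forall X Y : C,
  exists (B : C) (i1 : hom X B) (i2 : hom Y B) (p1 : hom B X) (p2 : hom B Y),
    [/\ p1 \oc i1 = idm X, p2 \oc i2 = idm Y, p1 \oc i2 = 0, p2 \oc i1 = 0
      & i1 \oc p1 + i2 \oc p2 = idm B].

Definition is_kernel (X Y Z : C) (i : hom X Y) (p : hom Y Z) : Prop :=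
  p \oc i = 0 /\
  forall (W : C) (g : hom W Y), p \oc g = 0 -> exists! h : hom W X, i \oc h = g.

Definition is_cokernel (X Y Z : C) (i : hom X Y) (p : hom Y Z) : Prop :=
  p \oc i = 0 /\
  forall (W : C) (g : hom Y W), g \oc i = 0 -> exists! h : hom Z W, h \oc p = g.

Definition is_pushout (X Y X' Y' : C) (i : hom X Y) (f : hom X X')
    (i' : hom X' Y') (f' : hom Y Y') : Prop :=
  f' \oc i = i' \oc f /\
  forall (W : C) (g : hom Y W) (g' : hom X' W), g \oc i = g' \oc f ->
    exists! h : hom Y' W, h \oc f' = g /\ h \oc i' = g'.

Definition is_pullback (Y Z Y' Z' : C) (p : hom Y Z) (f : hom Z' Z)
    (p' : hom Y' Z') (f' : hom Y' Y) : Prop :=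
  p \oc f' = f \oc p' /\
  forall (W : C) (g : hom W Y) (g' : hom W Z'), p \oc g = f \oc g' ->
    exists! h : hom W Y', f' \oc h = g /\ p' \oc h = g'.

End Preadditive.

Record conflation_category := ConflationCategory {
  conf_cat :> preadditive;
  conflation : forall X Y Z : conf_cat, hom X Y -> hom Y Z -> Prop }.

Section Exact.
Variable E : conflation_category.

Definition inflation (X Y : E) (i : hom X Y) : Prop :=
  exists (Z : E) (p : hom Y Z), conflation i p.

Definition deflation (Y Z : E) (p : hom Y Z) : Prop :=
  exists (X : E) (i : hom X Y), conflation i p.

(* Quillen's axioms, in the form of Buehler's survey "Exact categories". *)
Record is_exact : Prop := IsExact {
  exact_zero : has_zero_object E;
  exact_biproducts : has_biproducts E;
  exact_ker : forall (X Y Z : E) (i : hom X Y) (p : hom Y Z),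
    conflation i p -> is_kernel i p;
  exact_coker : forall (X Y Z : E) (i : hom X Y) (p : hom Y Z),
    conflation i p -> is_cokernel i p;
  exact_iso : forall (X Y Z X' Y' Z' : E) (i : hom X Y) (p : hom Y Z)
      (i' : hom X' Y') (p' : hom Y' Z')
      (a : hom X X') (b : hom Y Y') (c : hom Z Z'),
    is_iso a -> is_iso b -> is_iso c ->
    b \oc i = i' \oc a -> c \oc p = p' \oc b ->
    conflation i p -> conflation i' p';
  exact_id_inflation : forall X : E, inflation (idm X);
  exact_id_deflation : forall X : E, deflation (idm X);
  exact_comp_inflation : forall (X Y Z : E) (i : hom X Y) (j : hom Y Z),
    inflation i -> inflation j -> inflation (j \oc i);
  exact_comp_deflation : forall (X Y Z : E) (p : hom X Y) (q : hom Y Z),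
    deflation p -> deflation q -> deflation (q \oc p);
  exact_pushout : forall (X Y X' : E) (i : hom X Y) (f : hom X X'),
    inflation i ->
    exists (Y' : E) (i' : hom X' Y') (f' : hom Y Y'),
      is_pushout i f i' f' /\ inflation i';
  exact_pullback : forall (Y Z Z' : E) (p : hom Y Z) (f : hom Z' Z),
    deflation p ->
    exists (Y' : E) (p' : hom Y' Z') (f' : hom Y' Y),
      is_pullback p f p' f' /\ deflation p' }.

Definition projective_object (P : E) : Prop :=
  forall (X Y : E) (p : hom X Y) (g : hom P Y),
    deflation p -> exists h : hom P X, p \oc h = g.

Definition injective_object (I : E) : Prop :=
  forall (X Y : E) (i : hom X Y) (g : hom X I),
    inflation i -> exists h : hom Y I, h \oc i = g.

Record proj_presentation (X : E) := ProjPresentation {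
  pc_proj : E; pc_syz : E; pc_incl : hom pc_syz pc_proj; pc_map : hom pc_proj X;
  pc_projP : projective_object pc_proj;
  pc_conf : conflation pc_incl pc_map }.

Record inj_copresentation (X : E) := InjCopresentation {
  ih_inj : E; ih_cosyz : E; ih_map : hom X ih_inj; ih_proj : hom ih_inj ih_cosyz;
  ih_injP : injective_object ih_inj;
  ih_conf : conflation ih_map ih_proj }.

Record is_frobenius : Prop := IsFrobenius {
  frob_exact : is_exact;
  frob_enough_proj : forall X : E, inhabited (proj_presentation X);
  frob_enough_inj : forall X : E, inhabited (inj_copresentation X);
  frob_proj_inj : forall X : E, projective_object X <-> injective_object X }.

End Exact.

Record frobenius_category := FrobeniusCategory {
  frob_cat :> conflation_category;
  frobP : is_frobenius frob_cat }.

Record additive_functor (C D : preadditive) := AdditiveFunctor {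
  fob :> C -> D;
  fhom : forall X Y : C, hom X Y -> hom (fob X) (fob Y);
  fhom_id : forall X : C, fhom (idm X) = idm (fob X);
  fhom_comp : forall (X Y Z : C) (g : hom Y Z) (f : hom X Y),
    fhom (g \oc f) = fhom g \oc fhom f;
  fhomD : forall (X Y : C) (f g : hom X Y), fhom (f + g) = fhom f + fhom g }.

Arguments fhom {C D} a {X Y} _.

Section Functors.

Definition id_functor (C : preadditive) : additive_functor C C :=
  @AdditiveFunctor C C id (fun _ _ f => f)
    (fun _ => erefl) (fun _ _ _ _ _ => erefl) (fun _ _ _ _ => erefl).

Section Composition.
Variables (C D K : preadditive).
Variables (G : additive_functor D K) (F : additive_functor C D).

Fact comp_functor_id (X : C) : fhom G (fhom F (idm X)) = idm (G (F X)).
Proof. by rewrite (fhom_id F) (fhom_id G). Qed.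
Fact comp_functor_comp (X Y Z : C) (g : hom Y Z) (f : hom X Y) :
  fhom G (fhom F (g \oc f)) = fhom G (fhom F g) \oc fhom G (fhom F f).
Proof. by rewrite (fhom_comp F) (fhom_comp G). Qed.
Fact comp_functorD (X Y : C) (f g : hom X Y) :
  fhom G (fhom F (f + g)) = fhom G (fhom F f) + fhom G (fhom F g).
Proof. by rewrite (fhomD F) (fhomD G). Qed.

Definition comp_functor : additive_functor C K :=
  AdditiveFunctor comp_functor_id comp_functor_comp comp_functorD.
End Composition.

Definition natural_iso (C D : preadditive) (F G : additive_functor C D)
    (eta : forall X : C, hom (F X) (G X)) : Prop :=
  (forall X, is_iso (eta X)) /\
  (forall (X Y : C) (f : hom X Y), eta Y \oc fhom F f = fhom G f \oc eta X).

Definition is_equivalence (C D : preadditive) (F : additive_functor C D) : Prop :=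
  exists G : additive_functor D C,
    (exists eta, @natural_iso C C (comp_functor G F) (id_functor C) eta) /\
    (exists eps, @natural_iso D D (comp_functor F G) (id_functor D) eps).

End Functors.

(* Only the data: Verdier's axioms hold for stable_triangulated below by
   Happel's theorem, and triangle functors do not refer to them. *)
Record triangulated := Triangulated {
  tri_cat :> preadditive;
  shift : additive_functor tri_cat tri_cat;
  distinguished : forall X Y Z : tri_cat,
    hom X Y -> hom Y Z -> hom Z (shift X) -> Prop }.

Record triangle_functor (T T' : triangulated) := TriangleFunctor {
  tri_fun :> additive_functor T T';
  tri_shift : forall X : T, hom (tri_fun (shift T X)) (shift T' (tri_fun X));
  tri_shift_iso : @natural_iso T T' (comp_functor tri_fun (shift T))
    (comp_functor (shift T') tri_fun) tri_shift;
  tri_distinguished : forall (X Y Z : T)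
      (u : hom X Y) (v : hom Y Z) (w : hom Z (shift T X)),
    distinguished u v w ->
    distinguished (fhom tri_fun u) (fhom tri_fun v)
      (tri_shift X \oc fhom tri_fun w) }.

Section Stable.
Variable E : frobenius_category.

Definition factors_through_projective (X Y : E) (f : hom X Y) : Prop :=
  exists P : E, projective_object P /\
    exists (u : hom X P) (v : hom P Y), f = v \oc u.

Definition stably_zero (X Y : E) : {pred hom X Y} :=
  fun f => `[< factors_through_projective f >].
Arguments stably_zero X Y : clear implicits.

Lemma stably_zeroP (X Y : E) (f : hom X Y) :
  reflect (factors_through_projective f) (f \in stably_zero X Y).
Proof. exact: asboolP. Qed.

Lemma stably_zero_closed (X Y : E) : zmod_closed (stably_zero X Y).
Proof.
have [exE enP _ _] := frobP E; split.
  have [[P _ _ p PP _]] := enP Y.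
  by apply/stably_zeroP; exists P; split=> //; exists 0, p; rewrite compm0.
move=> f g /stably_zeroP[P [PP [u [v ->]]]] /stably_zeroP[Q [PQ [s [t ->]]]].
have [B [i1 [i2 [p1 [p2 [e11 e22 e12 e21 e]]]]]] := exact_biproducts exE P Q.
apply/stably_zeroP; exists B; split.
  move=> A A' p h pdef.
  have [a ea] := PP _ _ p (h \oc i1) pdef.
  have [b eb] := PQ _ _ p (h \oc i2) pdef.
  exists (a \oc p1 + b \oc p2).
  by rewrite compmD !compA ea eb -!compA -compmD e compm1.
exists (i1 \oc u + i2 \oc s), (v \oc p1 - t \oc p2).
rewrite compmD !compBm -!compA !(compA p1) !(compA p2) e11 e12 e21 e22.
by rewrite !comp0m !comp1m !compm0 subr0 sub0r.
Qed.

HB.instance Definition _ (X Y : E) :=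
  GRing.isZmodClosed.Build (hom X Y) (stably_zero X Y)
    (stably_zero_closed X Y).

Lemma stably_zero_compl (X Y Z : E) (g : hom Y Z) (f : hom X Y) :
  f \in stably_zero X Y -> g \oc f \in stably_zero X Z.
Proof.
move=> /stably_zeroP[P [PP [u [v ->]]]]; apply/stably_zeroP.
by exists P; split=> //; exists u, (g \oc v); rewrite compA.
Qed.

Lemma stably_zero_compr (X Y Z : E) (g : hom Y Z) (f : hom X Y) :
  g \in stably_zero Y Z -> g \oc f \in stably_zero X Z.
Proof.
move=> /stably_zeroP[P [PP [u [v ->]]]]; apply/stably_zeroP.
by exists P; split=> //; exists (u \oc f), v; rewrite compA.
Qed.

Definition stable_hom (X Y : E) : zmodType :=
  Quotient.quot (stably_zero X Y : zmodClosed (hom X Y)).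

Definition stab (X Y : E) (f : hom X Y) : stable_hom X Y :=
  \pi_(stable_hom X Y)%qT f.

Lemma stab_eq (X Y : E) (f g : hom X Y) :
  f - g \in stably_zero X Y <-> stab f = stab g.
Proof. by rewrite Quotient.idealrBE; split=> /eqP. Qed.

Lemma stabD (X Y : E) (f g : hom X Y) : stab (f + g) = stab f + stab g.
Proof. by rewrite /stab raddfD. Qed.

Definition stab_repr (X Y : E) (f : stable_hom X Y) : hom X Y := repr f.

Lemma stab_reprK (X Y : E) (f : stable_hom X Y) : stab (stab_repr f) = f.
Proof. exact: reprK. Qed.

Definition stable_comp (X Y Z : E) (g : stable_hom Y Z) (f : stable_hom X Y) :
  stable_hom X Z := stab (stab_repr g \oc stab_repr f).

Lemma stab_comp (X Y Z : E) (g : hom Y Z) (f : hom X Y) :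
  stable_comp (stab g) (stab f) = stab (g \oc f).
Proof.
apply/stab_eq; set g' := stab_repr _; set f' := stab_repr _.
have -> : g' \oc f' - g \oc f = g' \oc (f' - f) + (g' - g) \oc f.
  by rewrite compmB compBm addrA subrK.
apply: rpredD.
  by apply/stably_zero_compl/stab_eq/stab_reprK.
by apply/stably_zero_compr/stab_eq/stab_reprK.
Qed.

Lemma stab_ind (X Y : E) (f : stable_hom X Y) : exists f', f = stab f'.
Proof. by exists (stab_repr f); rewrite stab_reprK. Qed.

Fact stable_compA X Y Z W (h : stable_hom Z W) (g : stable_hom Y Z)
    (f : stable_hom X Y) :
  stable_comp h (stable_comp g f) = stable_comp (stable_comp h g) f.
Proof.
have [h' ->] := stab_ind h; have [g' ->] := stab_ind g.
by have [f' ->] := stab_ind f; rewrite !stab_comp compA.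
Qed.

Fact stable_comp1m X Y (f : stable_hom X Y) : stable_comp (stab (idm Y)) f = f.
Proof. by have [f' ->] := stab_ind f; rewrite stab_comp comp1m. Qed.

Fact stable_compm1 X Y (f : stable_hom X Y) : stable_comp f (stab (idm X)) = f.
Proof. by have [f' ->] := stab_ind f; rewrite stab_comp compm1. Qed.

Fact stable_compDm X Y Z (g g' : stable_hom Y Z) (f : stable_hom X Y) :
  stable_comp (g + g') f = stable_comp g f + stable_comp g' f.
Proof.
have [h ->] := stab_ind g; have [h' ->] := stab_ind g'.
by have [f' ->] := stab_ind f; rewrite -stabD !stab_comp compDm stabD.
Qed.

Fact stable_compmD X Y Z (g : stable_hom Y Z) (f f' : stable_hom X Y) :
  stable_comp g (f + f') = stable_comp g f + stable_comp g f'.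
Proof.
have [h ->] := stab_ind f; have [h' ->] := stab_ind f'.
by have [k ->] := stab_ind g; rewrite -stabD !stab_comp compmD stabD.
Qed.

Definition stable_category : preadditive :=
  Preadditive stable_compA stable_comp1m stable_compm1
    stable_compDm stable_compmD.

Definition copres (X : E) : inj_copresentation X :=
  inhabited_witness (frob_enough_inj (frobP E) X).

Definition cosyzygy (X : E) : E := ih_cosyz (copres X).

Definition cosyzygy_lift (X Y : E) (f : hom X Y)
    (c : hom (cosyzygy X) (cosyzygy Y)) : Prop :=
  exists b : hom (ih_inj (copres X)) (ih_inj (copres Y)),
    b \oc ih_map (copres X) = ih_map (copres Y) \oc f /\
    c \oc ih_proj (copres X) = ih_proj (copres Y) \oc b.

Lemma cosyzygy_lift_exists (X Y : E) (f : hom X Y) :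
  exists c, cosyzygy_lift f c.
Proof.
have exE := frob_exact (frobP E).
have Xinfl : inflation (ih_map (copres X)).
  by exists (ih_cosyz (copres X)), (ih_proj (copres X)); apply: ih_conf.
have [b eb] := ih_injP (ih_map (copres Y) \oc f) Xinfl.
have [_ univ] := exact_coker exE (ih_conf (copres X)).
have [|c [ec _]] := univ _ (ih_proj (copres Y) \oc b).
  have [e0 _] := exact_coker exE (ih_conf (copres Y)).
  by rewrite -compA eb compA e0 comp0m.
by exists c, b.
Qed.

Lemma conflation_epi (X Y Z W : E) (i : hom X Y) (p : hom Y Z)
    (g g' : hom Z W) :
  conflation i p -> g \oc p = g' \oc p -> g = g'.
Proof.
move=> ip e; have [pi0 univ] := exact_coker (frob_exact (frobP E)) ip.
have [|h [_ uh]] := univ _ (g \oc p); first by rewrite -compA pi0 compm0.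
by rewrite -(uh g erefl) (uh g').
Qed.

Lemma cosyzygy_lift_unique (X Y : E) (f f' : hom X Y)
    (c c' : hom (cosyzygy X) (cosyzygy Y)) :
  cosyzygy_lift f c -> cosyzygy_lift f' c' -> stab f = stab f' ->
  stab c = stab c'.
Proof.
have [exE _ _ PI] := frobP E.
move=> [b [eb ec]] [b' [eb' ec']] /stab_eq/stably_zeroP[P [PP [u [v euv]]]].
have Xinfl : inflation (ih_map (copres X)).
  by exists (ih_cosyz (copres X)), (ih_proj (copres X)); apply: ih_conf.
have [u' eu] := (PI P).1 PP _ _ _ u Xinfl.
have [_ univ] := exact_coker exE (ih_conf (copres X)).
have [|h [eh _]] := univ _ (b - b' - ih_map (copres Y) \oc v \oc u').
  rewrite !compBm eb eb' -compmB euv -!compA eu.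
  by rewrite subrr.
apply/stab_eq/stably_zeroP; exists (ih_inj (copres Y)); split.
  by apply/PI; apply: ih_injP.
exists h, (ih_proj (copres Y)); apply: (conflation_epi (ih_conf (copres X))).
have [e0 _] := exact_coker exE (ih_conf (copres Y)).
by rewrite -compA eh compBm ec ec' !compmB !compA e0 !comp0m subr0.
Qed.

Definition cosyzygy_map (X Y : E) (f : stable_hom X Y) :
    stable_hom (cosyzygy X) (cosyzygy Y) :=
  stab (sval (cid (cosyzygy_lift_exists (stab_repr f)))).

Lemma cosyzygy_mapE (X Y : E) (f : hom X Y) c :
  cosyzygy_lift f c -> cosyzygy_map (stab f) = stab c.
Proof.
move=> fc; apply: (cosyzygy_lift_unique _ fc); last exact: stab_reprK.
exact: svalP (cid (cosyzygy_lift_exists (stab_repr (stab f)))).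
Qed.

Fact cosyzygy_map_id (X : E) :
  cosyzygy_map (stab (idm X)) = stab (idm (cosyzygy X)).
Proof.
apply: cosyzygy_mapE; exists (idm _).
by rewrite !comp1m !compm1.
Qed.

Fact cosyzygy_map_comp (X Y Z : stable_category) (g : hom Y Z) (f : hom X Y) :
  cosyzygy_map (g \oc f) = stable_comp (cosyzygy_map g) (cosyzygy_map f).
Proof.
have [g' ->] := stab_ind g; have [f' ->] := stab_ind f.
have [c cl] := cosyzygy_lift_exists g'.
have [d dl] := cosyzygy_lift_exists f'.
rewrite (cosyzygy_mapE cl) (cosyzygy_mapE dl) /= !stab_comp.
apply: cosyzygy_mapE.
case: cl dl => [b [eb ec]] [b' [eb' ed]]; exists (b \oc b').
by split; [rewrite -compA eb' !compA eb | rewrite -compA ed !compA ec].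
Qed.

Fact cosyzygy_mapD (X Y : stable_category) (f g : hom X Y) :
  cosyzygy_map (f + g) = cosyzygy_map f + cosyzygy_map g.
Proof.
have [g' ->] := stab_ind g; have [f' ->] := stab_ind f.
have [c cl] := cosyzygy_lift_exists g'.
have [d dl] := cosyzygy_lift_exists f'.
rewrite (cosyzygy_mapE cl) (cosyzygy_mapE dl) -!stabD.
apply: cosyzygy_mapE.
case: cl dl => [b [eb ec]] [b' [eb' ed]]; exists (b' + b).
by rewrite !compDm !compmD eb eb' ec ed.
Qed.

Definition cosyzygy_functor : additive_functor stable_category stable_category :=
  @AdditiveFunctor stable_category stable_category cosyzygy cosyzygy_map
    cosyzygy_map_id cosyzygy_map_comp cosyzygy_mapD.

(* A conflation X -u-> Y -v-> Z maps to X -i-> I -p-> cosyzygy X by id_X, some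
   b : Y -> I and the induced h : Z -> cosyzygy X; its triangle is (u, v, -h).
   With this sign the triangles are Happel's: let C be the pushout of i along u,
   q : C -> Z the induced map, which is a stable isomorphism, and
   r : C -> cosyzygy X the map of Happel's triangle X -> Y -> C -> cosyzygy X.
   Then h q + r factors through I, so that r = -h q stably. *)
Definition standard_triangle (X Y Z : stable_category)
    (u : hom X Y) (v : hom Y Z) (w : hom Z (cosyzygy_functor X)) : Prop :=
  exists (u' : @hom E X Y) (v' : @hom E Y Z)
         (b : @hom E Y (ih_inj (copres X))) (h : @hom E Z (cosyzygy X)),
    [/\ conflation u' v',
        b \oc u' = ih_map (copres X), h \oc v' = ih_proj (copres X) \oc b
      & [/\ u = stab u', v = stab v' & w = - stab h]].

Definition stable_distinguished (X Y Z : stable_category)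
    (u : hom X Y) (v : hom Y Z) (w : hom Z (cosyzygy_functor X)) : Prop :=
  exists (X' Y' Z' : stable_category)
    (u' : hom X' Y') (v' : hom Y' Z') (w' : hom Z' (cosyzygy_functor X'))
    (a : hom X X') (b : hom Y Y') (c : hom Z Z'),
    [/\ standard_triangle u' v' w', is_iso a, is_iso b, is_iso c
      & [/\ b \oc u = u' \oc a, c \oc v = v' \oc b
          & fhom cosyzygy_functor a \oc w = w' \oc c]].

Definition stable_triangulated : triangulated :=
  @Triangulated stable_category cosyzygy_functor stable_distinguished.

End Stable.

Section MonMF.
Variables (S : comNzRingType) (w : S).

Record mon_object := MonObject {
  mon1 : lmodType S;
  mon0 : lmodType S;
  mon_map : {linear mon1 -> mon0};
  mon1_gp : gorenstein_projective mon1;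
  mon0_gp : gorenstein_projective mon0;
  mon_inj : injective mon_map;
  (* w Coker(mon_map) = 0, i.e. w mon0 lies in the image of mon_map *)
  mon_coker : forall x : mon0, exists y : mon1, mon_map y = w *: x }.

Local Notation mon_pair X Y :=
  ({linear mon1 X -> mon1 Y} * {linear mon0 X -> mon0 Y})%type.

Definition mon_commutes (X Y : mon_object) : {pred mon_pair X Y} :=
  fun f => `[< forall x, mon_map Y (f.1 x) = f.2 (mon_map X x) >].
Arguments mon_commutes X Y : clear implicits.

Fact mon_commutes_closed X Y : zmod_closed (mon_commutes X Y).
Proof.
split=> [|f g /asboolP ef /asboolP eg]; apply/asboolP => x /=.
  exact: raddf0.
by rewrite linearB ef eg.
Qed.
HB.instance Definition _ X Y :=
  GRing.isZmodClosed.Build (mon_pair X Y)%type (mon_commutes X Y)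
    (mon_commutes_closed X Y).

Record mon_hom (X Y : mon_object) := MonHom {
  mon_hom_val :> mon_pair X Y;
  mon_homP : mon_hom_val \in mon_commutes X Y }.

HB.instance Definition _ X Y := [isSub for @mon_hom_val X Y].
HB.instance Definition _ X Y := [Choice of mon_hom X Y by <:].
HB.instance Definition _ X Y := [SubChoice_isSubZmodule of mon_hom X Y by <:].

Definition pair_id (A B : lmodType S) :
  {linear A -> A} * {linear B -> B} :=
  (idfun : {linear A -> A}, idfun : {linear B -> B}).

Definition pair_comp (A B A' B' A'' B'' : lmodType S)
    (g : {linear A' -> A''} * {linear B' -> B''})
    (f : {linear A -> A'} * {linear B -> B'}) :
  {linear A -> A''} * {linear B -> B''} :=
  (g.1 \o f.1 : {linear A -> A''}, g.2 \o f.2 : {linear B -> B''}).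

Fact mon_id_subproof X : pair_id (mon1 X) (mon0 X) \in mon_commutes X X.
Proof. exact/asboolP. Qed.
Definition mon_id X : mon_hom X X := MonHom (mon_id_subproof X).

Fact mon_comp_subproof X Y Z (g : mon_hom Y Z) (f : mon_hom X Y) :
  pair_comp (mon_hom_val g) (mon_hom_val f) \in mon_commutes X Z.
Proof.
have /asboolP eg := mon_homP g; have /asboolP ef := mon_homP f.
by apply/asboolP => x /=; rewrite eg ef.
Qed.
Definition mon_comp X Y Z (g : mon_hom Y Z) (f : mon_hom X Y) : mon_hom X Z :=
  MonHom (mon_comp_subproof g f).

Lemma mon_hom_ext X Y (f g : mon_hom X Y) :
  f.1 =1 g.1 -> f.2 =1 g.2 -> f = g.
Proof.
move=> e1 e2; apply: val_inj; rewrite /= [LHS]surjective_pairing.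
by rewrite (linear_ext e1) (linear_ext e2) -surjective_pairing.
Qed.

Fact mon_compA X Y Z W (h : mon_hom Z W) (g : mon_hom Y Z) (f : mon_hom X Y) :
  mon_comp h (mon_comp g f) = mon_comp (mon_comp h g) f.
Proof. exact: mon_hom_ext. Qed.
Fact mon_comp1m X Y (f : mon_hom X Y) : mon_comp (mon_id Y) f = f.
Proof. exact: mon_hom_ext. Qed.
Fact mon_compm1 X Y (f : mon_hom X Y) : mon_comp f (mon_id X) = f.
Proof. exact: mon_hom_ext. Qed.
Fact mon_compDm X Y Z (g g' : mon_hom Y Z) (f : mon_hom X Y) :
  mon_comp (g + g') f = mon_comp g f + mon_comp g' f.
Proof. exact: mon_hom_ext. Qed.
Fact mon_compmD X Y Z (g : mon_hom Y Z) (f f' : mon_hom X Y) :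
  mon_comp g (f + f') = mon_comp g f + mon_comp g f'.
Proof. by apply: mon_hom_ext => x /=; rewrite linearD. Qed.

Definition mon_preadditive : preadditive :=
  Preadditive mon_compA mon_comp1m mon_compm1 mon_compDm mon_compmD.

Definition mon_conflation (X Y Z : mon_preadditive)
    (i : mon_hom X Y) (p : mon_hom Y Z) : Prop :=
  short_exact i.1 p.1 /\ short_exact i.2 p.2.

Definition Mon : conflation_category :=
  @ConflationCategory mon_preadditive mon_conflation.

Record mf_object := MFObject {
  mf1 : lmodType S;
  mf0 : lmodType S;
  mf_map1 : {linear mf1 -> mf0};
  mf_map0 : {linear mf0 -> mf1};
  mf1_gp : gorenstein_projective mf1;
  mf0_gp : gorenstein_projective mf0;
  mf_map10 : forall x : mf0, mf_map1 (mf_map0 x) = w *: x;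
  mf_map01 : forall x : mf1, mf_map0 (mf_map1 x) = w *: x }.

Local Notation mf_pair X Y :=
  ({linear mf1 X -> mf1 Y} * {linear mf0 X -> mf0 Y})%type.

Definition mf_commutes (X Y : mf_object) : {pred mf_pair X Y} :=
  fun f => `[< (forall x, mf_map1 Y (f.1 x) = f.2 (mf_map1 X x)) /\
               (forall x, mf_map0 Y (f.2 x) = f.1 (mf_map0 X x)) >].
Arguments mf_commutes X Y : clear implicits.

Fact mf_commutes_closed X Y : zmod_closed (mf_commutes X Y).
Proof.
split=> [|f g /asboolP[ef1 ef0] /asboolP[eg1 eg0]]; apply/asboolP.
  by split=> x /=; apply: raddf0.
by split=> x /=; rewrite linearB ?ef1 ?eg1 ?ef0 ?eg0.
Qed.
HB.instance Definition _ X Y :=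
  GRing.isZmodClosed.Build (mf_pair X Y)%type (mf_commutes X Y)
    (mf_commutes_closed X Y).

Record mf_hom (X Y : mf_object) := MFHom {
  mf_hom_val :> mf_pair X Y;
  mf_homP : mf_hom_val \in mf_commutes X Y }.

HB.instance Definition _ X Y := [isSub for @mf_hom_val X Y].
HB.instance Definition _ X Y := [Choice of mf_hom X Y by <:].
HB.instance Definition _ X Y := [SubChoice_isSubZmodule of mf_hom X Y by <:].

Fact mf_id_subproof X : pair_id (mf1 X) (mf0 X) \in mf_commutes X X.
Proof. exact/asboolP. Qed.
Definition mf_id X : mf_hom X X := MFHom (mf_id_subproof X).

Fact mf_comp_subproof X Y Z (g : mf_hom Y Z) (f : mf_hom X Y) :
  pair_comp (mf_hom_val g) (mf_hom_val f) \in mf_commutes X Z.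
Proof.
have /asboolP[eg1 eg0] := mf_homP g; have /asboolP[ef1 ef0] := mf_homP f.
by apply/asboolP; split=> x /=; rewrite ?eg1 ?ef1 ?eg0 ?ef0.
Qed.
Definition mf_comp X Y Z (g : mf_hom Y Z) (f : mf_hom X Y) : mf_hom X Z :=
  MFHom (mf_comp_subproof g f).

Lemma mf_hom_ext X Y (f g : mf_hom X Y) : f.1 =1 g.1 -> f.2 =1 g.2 -> f = g.
Proof.
move=> e1 e2; apply: val_inj; rewrite /= [LHS]surjective_pairing.
by rewrite (linear_ext e1) (linear_ext e2) -surjective_pairing.
Qed.

Fact mf_compA X Y Z W (h : mf_hom Z W) (g : mf_hom Y Z) (f : mf_hom X Y) :
  mf_comp h (mf_comp g f) = mf_comp (mf_comp h g) f.
Proof. exact: mf_hom_ext. Qed.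
Fact mf_comp1m X Y (f : mf_hom X Y) : mf_comp (mf_id Y) f = f.
Proof. exact: mf_hom_ext. Qed.
Fact mf_compm1 X Y (f : mf_hom X Y) : mf_comp f (mf_id X) = f.
Proof. exact: mf_hom_ext. Qed.
Fact mf_compDm X Y Z (g g' : mf_hom Y Z) (f : mf_hom X Y) :
  mf_comp (g + g') f = mf_comp g f + mf_comp g' f.
Proof. exact: mf_hom_ext. Qed.
Fact mf_compmD X Y Z (g : mf_hom Y Z) (f f' : mf_hom X Y) :
  mf_comp g (f + f') = mf_comp g f + mf_comp g f'.
Proof. by apply: mf_hom_ext => x /=; rewrite linearD. Qed.

Definition mf_preadditive : preadditive :=
  Preadditive mf_compA mf_comp1m mf_compm1 mf_compDm mf_compmD.

Definition mf_conflation (X Y Z : mf_preadditive)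
    (i : mf_hom X Y) (p : mf_hom Y Z) : Prop :=
  short_exact i.1 p.1 /\ short_exact i.2 p.2.

Definition MF : conflation_category :=
  @ConflationCategory mf_preadditive mf_conflation.

End MonMF.

(* Main.v *)
(* The heart is that MF(w, G) is a Frobenius category.  Gorenstein projective
   modules are closed under extensions, under kernels of surjections from S^n,
   and under cokernels of embeddings into S^n along which linear forms extend;
   the first gives exactness, the other two enough projectives and injectives,
   namely the sums of factorizations (1, w) and (w, 1) of free modules.
   Since w is regular on the torsionless module G_1, the map g_1 of a matrix
   factorization is injective and determines g_0, so forgetting g_0 identifies
   MF(w, G) with Mon(w, G) as exact categories.  An exact equivalence matching
   the projective objects induces a triangle equivalence on stable
   categories. *)
From HB Require Import structures.
From mathcomp Require Import all_boot all_algebra all_classical.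
From mathcomp Require finmap monalg.
Require Import Defs.

Set Implicit Arguments.
Unset Strict Implicit.
Unset Printing Implicit Defensive.

Import GRing.Theory.
Local Open Scope ring_scope.

(** * Linear maps, kernels, cokernels and free modules *)

(** [Ext_zero] asserts only that some resolution works, whereas the closure properties must be
    applied to whatever extension or cover is at hand. It is therefore traded for [ext_vanish],
    which quantifies over all short exact sequences and whose formal properties follow from
    pullbacks and splittings, in place of long exact sequences.

    The factorizations of free modules are projective and injective because they are adjoint to the
    two components: a morphism from [mf_free n m] to X is a pair of linear maps S^n -> [mf1 X], S^m
    -> [mf0 X], and a morphism from X to it is a pair [mf0 X] -> S^n, [mf1 X] -> S^m. Lifting then
    reduces to freeness, and extending to Ext^1(-, S) = 0 on Gorenstein projective cokernels.

    Exactness is verified for MF, where the two components can be treated separately. The functor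
    from Mon to MF is surjective on objects up to equality, not merely up to isomorphism, so
    existential axioms pull back literally. It need not preserve the chosen injective
    copresentations, so the shifts agree only up to a comparison of two cosyzygies of the same
    object. *)

Section LinearMaps.
Variable S : comNzRingType.
Implicit Types A B C K M N P W : lmodType S.

Lemma linear_of A B (f : A -> B) :
  linear f -> exists g : {linear A -> B}, g =1 f.
Proof.
move=> lf.
pose g : {linear A -> B} := HB.pack f (GRing.isLinear.Build S A B *:%R f lf).
by exists g.
Qed.

(** A linear relation whose only value at 0 is 0 is single-valued, since the difference of two
    values at x is a value at 0. All liftings and factorizations below are built this way, by
    describing the graph of the map. *)
Lemma linear_choice A B (R : A -> B -> Prop) :
    (forall x, exists y, R x y) -> (forall y, R 0 y -> y = 0) ->
    (forall a x x' y y', R x y -> R x' y' -> R (a *: x + x') (a *: y + y')) ->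
  exists f : {linear A -> B}, forall x y, R x y -> f x = y.
Proof.
move=> tot R0 lin.
have fn x y y' : R x y -> R x y' -> y = y'.
  move=> Ry Ry'; have := lin (-1) _ _ _ _ Ry Ry'.
  by rewrite !scaleN1r addNr => /R0/eqP; rewrite addrC subr_eq0 => /eqP.
have [f Rf] := choice tot.
have lf : linear f.
  by move=> a x y; apply: (fn (a *: x + y)); [|apply: lin]; apply: Rf.
have [g eg] := linear_of lf.
by exists g => x y Rxy; rewrite eg; apply: fn Rxy.
Qed.

Lemma lift_mono A B W (i : {linear A -> B}) (f : {linear W -> B}) :
    injective i -> (forall x, exists a, i a = f x) ->
  exists g : {linear W -> A}, forall x, i (g x) = f x.
Proof.
move=> ii im.
have [|y|a x x' y y' e e'|g eg] := @linear_choice _ _ (fun x a => i a = f x).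
- exact: im.
- by rewrite raddf0 -(raddf0 i) => /ii.
- by rewrite !linearP e e'.
by exists g => x; have [a ea] := im x; rewrite (eg x a ea).
Qed.

Lemma lift_epi B C W (p : {linear B -> C}) (f : {linear B -> W}) :
    (forall z, exists y, p y = z) -> (forall y, p y = 0 -> f y = 0) ->
  exists g : {linear C -> W}, forall y, g (p y) = f y.
Proof.
move=> sp k0.
have [z|y [x [px <-]]|a x x' y y' [u [<- <-]] [v [<- <-]]|g eg] :=
  @linear_choice _ _ (fun z u => exists y, p y = z /\ f y = u).
- by have [y <-] := sp z; exists (f y), y.
- exact: k0.
- by exists (a *: u + v); rewrite !linearP.
by exists g => y; apply: eg; exists y.
Qed.

Lemma inj_ker0 A B (f : {linear A -> B}) :
  (forall x, f x = 0 -> x = 0) -> injective f.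
Proof.
move=> k0 x y /eqP; rewrite -subr_eq0 -linearB => /eqP/k0/eqP.
by rewrite subr_eq0 => /eqP.
Qed.

Section Ker.
Variables (A B : lmodType S) (f : {linear A -> B}).
Definition lker_pred : {pred A} := fun x => `[< f x = 0 >].
Fact lker_closed : submod_closed lker_pred.
Proof.
split=> [|a x y /asboolP ex /asboolP ey]; apply/asboolP; first exact: raddf0.
by rewrite linearP ex ey scaler0 addr0.
Qed.
HB.instance Definition _ := GRing.isSubmodClosed.Build S A lker_pred lker_closed.
Record lker := LKer { lker_val :> A; lker_valP : lker_val \in lker_pred }.
HB.instance Definition _ := [isSub for lker_val].
HB.instance Definition _ := [Choice of lker by <:].
HB.instance Definition _ := [SubChoice_isSubLmodule of lker by <:].
Definition lker_incl : {linear lker -> A} := (val : {linear _ -> _}).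
End Ker.

Section Coker.
Variables (A B : lmodType S) (f : {linear A -> B}).
Definition limg_pred : {pred B} := fun y => `[< exists x, f x = y >].
Fact limg_closed : zmod_closed limg_pred.
Proof.
split=> [|x y /asboolP[u <-] /asboolP[v <-]]; apply/asboolP.
  by exists 0; rewrite raddf0.
by exists (u - v); rewrite linearB.
Qed.
HB.instance Definition _ := GRing.isZmodClosed.Build B limg_pred limg_closed.
Definition lcoker := Quotient.quot (limg_pred : zmodClosed B).
HB.instance Definition _ := GRing.Zmodule.on lcoker.

Lemma lcoker_eq (x y : B) :
  \pi_(lcoker)%qT x = \pi_(lcoker)%qT y <-> exists a, f a = x - y.
Proof.
split=> [/eqP|e]; first by rewrite -Quotient.idealrBE => /asboolP.
by apply/eqP; rewrite -Quotient.idealrBE; apply/asboolP.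
Qed.

Definition lcoker_scale (a : S) (x : lcoker) : lcoker :=
  \pi_(lcoker)%qT (a *: repr x).

Lemma lcoker_scaleE a x :
  lcoker_scale a (\pi_(lcoker)%qT x) = \pi_(lcoker)%qT (a *: x).
Proof.
apply/lcoker_eq.
have /lcoker_eq[u eu] :
    \pi_(lcoker)%qT (repr (\pi_(lcoker)%qT x)) = \pi_(lcoker)%qT x.
  by rewrite reprK.
by exists (a *: u); rewrite linearZ_LR eu scalerBr.
Qed.

Lemma lcoker_ind (x : lcoker) : exists y, x = \pi_(lcoker)%qT y.
Proof. by exists (repr x); rewrite reprK. Qed.

Fact lcoker_scaleA a b x :
  lcoker_scale a (lcoker_scale b x) = lcoker_scale (a * b) x.
Proof. by have [y ->] := lcoker_ind x; rewrite !lcoker_scaleE scalerA. Qed.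
Fact lcoker_scale1 : left_id 1 lcoker_scale.
Proof.
by move=> x; have [y ->] := lcoker_ind x; rewrite !lcoker_scaleE scale1r.
Qed.
Fact lcoker_scaleDr : right_distributive lcoker_scale +%R.
Proof.
move=> a x y; have [x' ->] := lcoker_ind x; have [y' ->] := lcoker_ind y.
by rewrite -raddfD !lcoker_scaleE scalerDr raddfD.
Qed.
Fact lcoker_scaleDl x : {morph lcoker_scale^~ x : a b / a + b}.
Proof.
move=> a b; have [x' ->] := lcoker_ind x.
by rewrite !lcoker_scaleE scalerDl raddfD.
Qed.
HB.instance Definition _ := GRing.Zmodule_isLmodule.Build S lcoker
  lcoker_scaleA lcoker_scale1 lcoker_scaleDr lcoker_scaleDl.
End Coker.

Lemma ker_exists A B (p : {linear A -> B}) :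
  exists K (i : {linear K -> A}),
    injective i /\ forall y, p y = 0 <-> exists x, i x = y.
Proof.
exists (lker p), (lker_incl p); split; first exact: val_inj.
move=> y; split=> [/asboolP py|[x <-]]; first by exists (LKer py).
exact/asboolP/(lker_valP x).
Qed.

Lemma coker_exists A B (i : {linear A -> B}) :
  exists C (p : {linear B -> C}),
    (forall z, exists y, p y = z) /\ forall y, p y = 0 <-> exists x, i x = y.
Proof.
have lp : linear (\pi_(lcoker i)%qT : B -> lcoker i).
  move=> a x y; rewrite raddfD; congr (_ + _).
  exact/esym/lcoker_scaleE.
have [p ep] := linear_of lp; exists (lcoker i), p; split=> [z|y].
  by have [y ->] := lcoker_ind z; exists y.
have -> : (p y = 0) = (\pi_(lcoker i)%qT y = \pi_(lcoker i)%qT 0).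
  by rewrite -!ep raddf0.
by split=> [/lcoker_eq|e]; [|apply/lcoker_eq]; rewrite subr0.
Qed.

Lemma short_exact_ker A B (p : {linear A -> B}) :
  (forall z, exists y, p y = z) ->
  exists K (i : {linear K -> A}), short_exact i p.
Proof. by move=> sp; have [K [i [ii ei]]] := ker_exists p; exists K, i. Qed.

Lemma short_exact_coker A B (i : {linear A -> B}) :
  injective i -> exists C (p : {linear B -> C}), short_exact i p.
Proof. by move=> ii; have [C [p [sp ep]]] := coker_exists i; exists C, p. Qed.

Lemma short_exact0 A B C (i : {linear A -> B}) (p : {linear B -> C}) :
  short_exact i p -> forall x, p (i x) = 0.
Proof. by case=> _ e _ x; apply/e; exists x. Qed.

End LinearMaps.

Section Free.
Import finmap monalg.
Variables (S : comNzRingType) (M : lmodType S).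
Local Open Scope fset_scope.
Local Notation F := {malg S[M]}.

(** [{malg S[M]}] is the free module on the underlying set of M; this is its universal property. *)
Lemma malg_lift (N : lmodType S) (f : M -> N) :
  exists g : {linear F -> N}, forall x, g << x >> = f x.
Proof.
pose h (x : F) : N := \sum_(k <- msupp x) x@_k *: f k.
have hE (x : F) (D : {fset M}) : msupp x `<=` D ->
    h x = \sum_(k <- D) x@_k *: f k.
  move=> xD; apply: big_fset_incl => // k _ /mcoeff_outdom ->.
  by rewrite scale0r.
have lh : linear h.
  move=> a x y.
  (* A common index set containing all three supports makes the defining sums comparable term by
     term. *)
  set D := msupp x `|` msupp y `|` msupp (a *: x + y).
  have Dx : msupp x `<=` D by rewrite /D -fsetUA fsubsetUl.
  have Dy : msupp y `<=` D by rewrite /D -fsetUA fsetUCA fsubsetUl.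
  rewrite (hE _ _ Dx) (hE _ _ Dy) (hE _ D) ?fsubsetUr //.
  rewrite scaler_sumr -big_split; apply: eq_bigr => k _ /=.
  by rewrite mcoeffD mcoeffZ scalerDl scalerA.
have [g eg] := linear_of lh; exists g => x.
by rewrite eg (hE _ [fset x]) ?msuppU_le // big_seq_fset1 mcoeffUU scale1r.
Qed.

Lemma malg_ext (N : lmodType S) (f g : {linear F -> N}) :
  (forall x, f << x >> = g << x >>) -> f =1 g.
Proof.
move=> e x; rewrite [x]monalgE !linear_sum; apply: eq_bigr => k _.
have -> : << x@_k *g k >> = x@_k *: << k >>.
  by apply/malgP => l; rewrite mcoeffZ !mcoeffU mulrnAr mulr1.
by rewrite !linearZ_LR e.
Qed.

(** The cover is free on all elements of M. It serves arbitrary modules, because [ext_vanish] and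
    its syzygies range over modules of any size. *)
Lemma enough_projective_modules :
  exists (P : lmodType S) (p : {linear P -> M}),
    projective_module P /\ forall z, exists y, p y = z.
Proof.
have [p ep] := malg_lift idfun; exists F, p; split=> [A B q g sq|z].
  have [s es] := choice (fun x : M => sq (g << x >>)).
  have [h eh] := malg_lift s; exists h.
  by apply: (@malg_ext B (q \o h : {linear _ -> _})) => x /=; rewrite eh es.
by exists << z >>; rewrite ep.
Qed.
End Free.

(** * Vanishing of Ext *)

Section Pullback.
Variable S : comNzRingType.
Implicit Types A B C D E K L M N P Q W : lmodType S.

Definition lcopair A B C (f : {linear A -> C}) (g : {linear B -> C}) :
    {linear (A * B)%type -> C} :=
  ((f \o fst) \+ (g \o snd) : {linear _ -> _}).

Definition pair_fun A B C (f : {linear A -> B}) (g : {linear A -> C}) (x : A) :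
  (B * C)%type := (f x, g x).
Fact pair_fun_is_linear A B C (f : {linear A -> B}) (g : {linear A -> C}) :
  linear (pair_fun f g).
Proof. by move=> a x y; rewrite /pair_fun !linearP. Qed.
HB.instance Definition _ A B C (f : {linear A -> B}) (g : {linear A -> C}) :=
  GRing.isLinear.Build S A (B * C)%type *:%R _ (pair_fun_is_linear f g).
Definition lpair A B C (f : {linear A -> B}) (g : {linear A -> C}) :
    {linear A -> (B * C)%type} := (pair_fun f g : {linear _ -> _}).

Record lpullback B C D Q (p : {linear B -> C}) (q : {linear D -> C})
    (u : {linear Q -> B}) (v : {linear Q -> D}) : Prop := LPullback {
  lpb_comm : forall x, p (u x) = q (v x);
  lpb_ex : forall b d, p b = q d -> exists x, u x = b /\ v x = d;
  lpb_inj : forall x, u x = 0 -> v x = 0 -> x = 0 }.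

Lemma lpullback_ker B C D K (p : {linear B -> C}) (q : {linear D -> C})
    (k : {linear K -> (B * D)%type}) :
    injective k ->
    (forall y, lcopair p (\- q : {linear _ -> _}) y = 0 <-> exists x, k x = y) ->
  lpullback p q (fst \o k : {linear _ -> _}) (snd \o k : {linear _ -> _}).
Proof.
move=> ik ek; split.
- move=> x /=; have /= /eqP := (ek (k x)).2 (ex_intro _ x erefl).
  by rewrite subr_eq0 => /eqP.
- move=> b d e; have [|x ex] := (ek (b, d)).1; first by rewrite /= e subrr.
  by exists x; rewrite /= ex.
- by move=> x /= e1 e2; apply: ik; rewrite raddf0 [LHS]surjective_pairing e1 e2.
Qed.

Lemma lpullback_exists B C D (p : {linear B -> C}) (q : {linear D -> C}) :
  exists Q (u : {linear Q -> B}) (v : {linear Q -> D}), lpullback p q u v.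
Proof.
have [Q [k [ik ek]]] := ker_exists (lcopair p (\- q : {linear _ -> _})).
by do 3!eexists; apply: lpullback_ker ik ek.
Qed.

Lemma lpullback_sym B C D Q (p : {linear B -> C}) (q : {linear D -> C})
    (u : {linear Q -> B}) (v : {linear Q -> D}) :
  lpullback p q u v -> lpullback q p v u.
Proof.
case=> c e i; split=> [x|b d ebd|x e1 e2]; first by rewrite c.
  by have [x []] := e d b (esym ebd); exists x.
exact: i.
Qed.

Lemma lpullback_lift B C D Q W (p : {linear B -> C}) (q : {linear D -> C})
    (u : {linear Q -> B}) (v : {linear Q -> D})
    (g : {linear W -> B}) (h : {linear W -> D}) :
    lpullback p q u v -> (forall x, p (g x) = q (h x)) ->
  exists k : {linear W -> Q}, forall x, u (k x) = g x /\ v (k x) = h x.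
Proof.
move=> pb gh.
have [x|y [/=]|a x x' y y' [e1 e2] [e3 e4]|k ek] :=
  @linear_choice _ _ _ (fun x y => g x = u y /\ h x = v y).
- by have [y [e1 e2]] := lpb_ex pb (gh x); exists y; rewrite e1 e2.
- by rewrite !raddf0 => /esym e1 /esym; apply: (lpb_inj pb).
- by rewrite !linearP e1 e2 e3 e4.
exists k => x; have [y [e1 e2]] := lpb_ex pb (gh x).
by rewrite (ek x y).
Qed.

(** Pulling an extension back along q leaves its kernel unchanged: A maps to Q with second component
    zero. *)
Lemma lpullback_short_exact A B C D Q (i : {linear A -> B}) (p : {linear B -> C})
    (q : {linear D -> C}) (u : {linear Q -> B}) (v : {linear Q -> D}) :
    lpullback p q u v -> short_exact i p ->
  exists j : {linear A -> Q}, short_exact j v /\ forall x, u (j x) = i x.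
Proof.
move=> pb ip; have pi0 := short_exact0 ip; have [ii ei sp] := ip.
have [|j ej] := lpullback_lift (g := i) (h := \0 : {linear _ -> _}) pb.
  by move=> x; rewrite raddf0 pi0.
exists j; split; last by move=> x; case: (ej x).
split=> [x y /(congr1 u)|y|z].
- by rewrite !(ej _).1 => /ii.
- split=> [vy|[x <-]]; last by case: (ej x).
  have [|x ex] := (ei (u y)).1; first by rewrite (lpb_comm pb) vy raddf0.
  exists x; apply/eqP; rewrite -subr_eq0; apply/eqP/(lpb_inj pb).
    by rewrite linearB (ej x).1 ex subrr.
  by rewrite linearB (ej x).2 vy subrr.
- have [b eb] := sp (q z).
  by have [x [_ <-]] := lpb_ex pb eb; exists x.
Qed.

(** L is the preimage of A under q, which is also the kernel of the composite E -> C; it is an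
    extension of A by K. *)
Lemma kernel_comp_short_exact K E A B C (a : {linear K -> E}) (q : {linear E -> B})
    (i : {linear A -> B}) (p : {linear B -> C}) :
    short_exact a q -> short_exact i p ->
  exists L (e : {linear L -> E}) (k : {linear K -> L}) (l : {linear L -> A}),
    [/\ short_exact e (p \o q : {linear _ -> _}), short_exact k l,
        forall x, e (k x) = a x & forall x, i (l x) = q (e x)].
Proof.
move=> aq ip; have qa0 := short_exact0 aq; have pi0 := short_exact0 ip.
have [ia ea sq] := aq; have [ii ei sp] := ip.
have [|L [e se]] := short_exact_ker (p := (p \o q : {linear _ -> _})).
  by move=> z; have [y <-] := sp z; have [x <-] := sq y; exists x.
have [ie ee _] := se.
have [|k ek] := lift_mono (f := a) ie.
  by move=> x; apply/ee; rewrite /= qa0 raddf0.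
have [|l el] := lift_mono (f := (q \o e : {linear _ -> _})) ii.
  by move=> x; apply/ei; apply/(ee (e x)); exists x.
exists L, e, k, l; split=> //; split=> [x y /(congr1 e)|y|z].
- by rewrite !ek => /ia.
- split=> [ly|[x <-]]; last by apply: ii; rewrite el /= ek qa0 raddf0.
  have [|x ex] := (ea (e y)).1; first by rewrite -[LHS]el ly raddf0.
  by exists x; apply: ie; rewrite ek.
- have [y ey] := sq (i z).
  have [|x ex] := (ee y).1; first by rewrite /= ey pi0.
  by exists x; apply: ii; rewrite el /= ex.
Qed.

Lemma projective_section A B P (i : {linear A -> B}) (p : {linear B -> P}) :
    projective_module P -> short_exact i p ->
  exists r : {linear B -> A}, cancel i r.
Proof.
move=> PP ip; have pi0 := short_exact0 ip; have [ii ei sp] := ip.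
have [s es] := PP _ _ p idfun sp.
have [|r er] := lift_mono (f := (idfun \- (s \o p) : {linear _ -> _})) ii.
  by move=> x; apply/ei; rewrite linearB /= es subrr.
by exists r => x; apply: ii; rewrite er /= pi0 raddf0 subr0.
Qed.

Lemma projective_module_retract M P (s : {linear M -> P}) (r : {linear P -> M}) :
  cancel s r -> projective_module P -> projective_module M.
Proof.
move=> sr PP A B p g sp; have [h eh] := PP _ _ p (g \o r : {linear _ -> _}) sp.
by exists (h \o s : {linear _ -> _}) => x /=; rewrite eh /= sr.
Qed.

Lemma projective_module_prod P Q :
  projective_module P -> projective_module Q ->
  projective_module (P * Q)%type.
Proof.
move=> PP PQ A B p g sp.
have [h eh] := PP _ _ p (g \o lpair idfun \0 : {linear _ -> _}) sp.
have [k ek] := PQ _ _ p (g \o lpair \0 idfun : {linear _ -> _}) sp.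
exists (lcopair h k) => -[x y]; rewrite /= linearD eh ek /= -linearD.
by congr (g (_, _)); rewrite ?addr0 ?add0r.
Qed.

End Pullback.

Section Ext.
Variables (S : comNzRingType) (N : lmodType S).
Implicit Types A B C D E K L M P Q W : lmodType S.

(** Surjectivity of Hom(B, N) -> Hom(A, N). *)
Definition extendable A B (i : {linear A -> B}) : Prop :=
  forall f : {linear A -> N}, exists h : {linear B -> N}, forall x, h (i x) = f x.

(* Ext^(n+1)(M, N) = 0, by Yoneda's description for n = 0 and by dimension
   shifting otherwise. *)
Fixpoint ext_vanish (n : nat) M : Prop :=
  match n with
  | 0%N => forall A B (i : {linear A -> B}) (p : {linear B -> M}),
      short_exact i p -> extendable i
  | m.+1 => forall K P (i : {linear K -> P}) (p : {linear P -> M}),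
      projective_module P -> short_exact i p -> ext_vanish m K
  end.

(** In degree 0 an extension of M is pulled back along r to an extension of M', where the map
    extends, and then restricted along the section s. In higher degrees a syzygy of M is exhibited
    as a retract of a syzygy of M'. *)
Lemma ext_vanish_retract n M M' (s : {linear M -> M'}) (r : {linear M' -> M}) :
  cancel s r -> ext_vanish n M' -> ext_vanish n M.
Proof.
elim: n M M' s r => [|n IHn] M M' s r sr /= vM'.
  move=> A B i p ip f; have pi0 := short_exact0 ip.
  have [Q [u [v pb]]] := lpullback_exists p r.
  have [j [jv ej]] := lpullback_short_exact pb ip.
  have [h eh] := vM' _ _ _ _ jv f.
  have [|t et] := lpullback_lift (g := idfun) (h := (s \o p : {linear _ -> _})) pb.
    by move=> x /=; rewrite sr.
  exists (h \o t : {linear _ -> _}) => x /=; rewrite -eh; congr (h _).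
  apply/eqP; rewrite -subr_eq0; apply/eqP/(lpb_inj pb); rewrite linearB.
    by rewrite (et _).1 ej subrr.
  by rewrite (et _).2 (short_exact0 jv) /= pi0 raddf0 subrr.
move=> K P i p PP ip; have pi0 := short_exact0 ip; have [ii ei sp] := ip.
(* The kernel R of r is a complement of M in M'. Adding a projective cover of R to P gives a
   projective cover of M' compatible with s and r, whose kernel contains K as a retract. *)
have [R [c [ic ec]]] := ker_exists r.
have [P' [q [PP' sq]]] := enough_projective_modules R.
pose t := lcopair (s \o p : {linear _ -> _}) (c \o q : {linear _ -> _}).
have rt x : r (t x) = p x.1.
  by rewrite /= linearD sr (ec (c (q x.2))).2 ?addr0 //; exists (q x.2).
have [z|K' [k kt]] := short_exact_ker (p := t).
  have [x ex] := sp (r z).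
  have [|y' ey'] := (ec (z - s (r z))).1; first by rewrite linearB sr subrr.
  have [y ey] := sq y'.
  by exists (x, y); rewrite /= ex ey ey' addrC subrK.
have [ik ek _] := kt.
have [|s' es'] := lift_mono (f := lpair i \0) ik.
  by move=> x; apply/ek; rewrite /= pi0 !raddf0 addr0.
have [|r' er'] := lift_mono (f := (fst \o k : {linear _ -> _})) ii.
  by move=> x; apply/ei; rewrite /= -rt (short_exact0 kt) raddf0.
apply: (IHn _ K' s' r'); first by move=> x; apply: ii; rewrite er' /= es'.
exact: (vM' _ _ _ _ (projective_module_prod PP PP') kt).
Qed.

Lemma ext_vanish_projective n P : projective_module P -> ext_vanish n P.
Proof.
elim: n P => [|n IHn] P PP /= => [A B i p ip f|K P' i p PP' ip].
  have [r ri] := projective_section PP ip.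
  by exists (f \o r : {linear _ -> _}) => x /=; rewrite ri.
have [r ri] := projective_section PP ip.
exact/IHn/(projective_module_retract ri).
Qed.

Section KernelStep.
Variable n : nat.
Hypothesis ext_vanish_ext :
  forall A B C (i : {linear A -> B}) (p : {linear B -> C}),
  short_exact i p -> ext_vanish n A -> ext_vanish n C -> ext_vanish n B.

(* Exactness of Ext^(n+1)(L, N) -> Ext^(n+1)(K, N) -> Ext^(n+2)(A, N): the
   pullback of L and P' over A is an extension of L by K', and it contains K as
   a direct summand because P' is projective. *)
Lemma ext_vanish_kernel_step K L A K' P'
    (k : {linear K -> L}) (l : {linear L -> A})
    (i : {linear K' -> P'}) (p : {linear P' -> A}) :
    short_exact k l -> short_exact i p -> projective_module P' ->
  ext_vanish n L -> ext_vanish n K' -> ext_vanish n K.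
Proof.
move=> kl ip PP' vL vK'.
have [Q [u [v pb]]] := lpullback_exists l p.
have [j [jv _]] := lpullback_short_exact pb kl.
have [j' [ju _]] := lpullback_short_exact (lpullback_sym pb) ip.
have [r rj] := projective_section PP' jv.
apply: (ext_vanish_retract rj).
exact: (ext_vanish_ext ju).
Qed.
End KernelStep.

(** With L the preimage of A in the module E that surjects onto B, a map on K is extended from K to
    L (quotient A) and from L to E (quotient C). In higher degrees L is a syzygy of C and an
    extension of A by the syzygy K of B, so the kernel step applies. *)
Lemma ext_vanish_extension n A B C (i : {linear A -> B}) (p : {linear B -> C}) :
  short_exact i p -> ext_vanish n A -> ext_vanish n C -> ext_vanish n B.
Proof.
elim: n A B C i p => [|n IHn] A B C i p ip vA vC.
  move=> K E a q aq f.
  have [L [e [k [l [se kl ek el]]]]] := kernel_comp_short_exact aq ip.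
  have [g eg] := vA _ _ _ _ kl f; have [h eh] := vC _ _ _ _ se g.
  by exists h => x; rewrite -ek eh eg.
move=> K P a q PP aq.
have [L [e [k [l [se kl ek el]]]]] := kernel_comp_short_exact aq ip.
have vL := vC _ _ _ _ PP se.
have [P' [p' [PP' sp']]] := enough_projective_modules A.
have [K' [i' ip']] := short_exact_ker sp'.
exact: (ext_vanish_kernel_step IHn kl ip' PP' vL (vA _ _ _ _ PP' ip')).
Qed.

(** One presentation suffices, by Schanuel's argument: the pullback of P and any other P' over M is
    an extension of P' by K that contains the other syzygy as a direct summand. *)
Lemma ext_vanish_syzygy n K P M (i : {linear K -> P}) (p : {linear P -> M}) :
  projective_module P -> short_exact i p ->
  ext_vanish n K -> ext_vanish n.+1 M.
Proof.
move=> PP ip vK K' P' i' p' PP' ip'.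
apply: (ext_vanish_kernel_step (@ext_vanish_extension n) ip' ip PP _ vK).
exact: ext_vanish_projective.
Qed.

(** Any extension B of M by A receives a map from the presentation, t : P -> B and t' : K -> A, and
    is the pushout of P and A along K. Hence f on A and an extension to P of f t' glue to a map on
    B. *)
Lemma ext_vanish_extendable K P M (i : {linear K -> P}) (p : {linear P -> M}) :
  projective_module P -> short_exact i p -> extendable i -> ext_vanish 0 M.
Proof.
move=> PP ip xi A B j q jq f.
have pi0 := short_exact0 ip; have qj0 := short_exact0 jq.
have [ii ei sp] := ip; have [ij ej sq] := jq.
have [t et] := PP _ _ q p sq.
have [|t' et'] := lift_mono (f := (t \o i : {linear _ -> _})) ij.
  by move=> x; apply/ej; rewrite /= et pi0.
have [h eh] := xi (f \o t' : {linear _ -> _}).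
have [b||g eg] := lift_epi (p := lcopair t j) (f := lcopair h f).
- have [x ex] := sp (q b).
  have [|a ea] := (ej (b - t x)).1; first by rewrite linearB et ex subrr.
  by exists (x, a); rewrite /= ea addrC subrK.
- move=> [x a] /= e.
  have [|k ek] := (ei x).1;
    first by rewrite -et -[LHS]addr0 -(qj0 a) -linearD e raddf0.
  rewrite -ek eh /= -linearD.
  suff -> : t' k + a = 0 by rewrite raddf0.
  by apply: ij; rewrite linearD et' /= ek e raddf0.
by exists g => x; have := eg (0, x); rewrite /= !raddf0 !add0r.
Qed.

Record presentation M := Presentation {
  pres_syz : lmodType S; pres_proj : lmodType S;
  pres_incl : {linear pres_syz -> pres_proj}; pres_map : {linear pres_proj -> M};
  pres_projP : projective_module pres_proj;
  pres_exact : short_exact pres_incl pres_map }.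

Lemma presentation_exists M : inhabited (presentation M).
Proof.
have [P [p [PP sp]]] := enough_projective_modules M.
by have [K [i ip]] := short_exact_ker sp; split; apply: (Presentation PP ip).
Qed.

(** Fixing one presentation of every module allows syzygies to be iterated and spliced into
    [syzygy_resolution]. *)
Definition pres M : presentation M := inhabited_witness (presentation_exists M).

Fixpoint syzygy M n : lmodType S :=
  if n is m.+1 then pres_syz (pres (syzygy M m)) else M.

Lemma ext_vanish_iter_syzygy k m M :
  ext_vanish (k + m) M -> ext_vanish m (syzygy M k).
Proof.
elim: k m => [//|k IHk] m; rewrite addSnnS => /IHk; apply.
- exact: pres_projP (pres (syzygy M k)).
- exact: pres_exact.
Qed.

Definition syzygy_diff M i :
    {linear pres_proj (pres (syzygy M i.+1)) -> pres_proj (pres (syzygy M i))} :=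
  (pres_incl (pres (syzygy M i)) \o pres_map (pres (syzygy M i.+1)) :
    {linear _ -> _}).

Lemma syzygy_diff_exact0 M y :
  pres_map (pres M) y = 0 <-> exists z, syzygy_diff M 0 z = y.
Proof.
have [_ e _] := pres_exact (pres M); have [_ _ s] := pres_exact (pres (syzygy M 1)).
split=> [/e[x <-]|[z <-]]; first by have [z <-] := s x; exists z.
exact: (short_exact0 (pres_exact (pres M))).
Qed.

Lemma syzygy_diff_exact M i y :
  syzygy_diff M i y = 0 <-> exists z, syzygy_diff M i.+1 z = y.
Proof.
have [j _ _] := pres_exact (pres (syzygy M i)).
apply: iff_trans (@syzygy_diff_exact0 (syzygy M i.+1) y).
split=> [e|/= ->]; last exact: raddf0.
by apply: j; rewrite [LHS]e raddf0.
Qed.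

Definition syzygy_resolution M : projective_resolution M :=
  @ProjectiveResolution S M (fun i => pres_proj (pres (syzygy M i)))
    (@syzygy_diff M) (pres_map (pres M))
    (fun i => @pres_projP _ (pres (syzygy M i)))
    (let: And3 _ _ s := pres_exact (pres M) in s)
    (@syzygy_diff_exact0 M) (@syzygy_diff_exact M).

(** A single resolution with vanishing cohomology controls all presentations: dropping its first
    term resolves the first syzygy, and [ext_vanish_syzygy] climbs back. Conversely, the resolution
    by chosen syzygies works. Degree n of [ext_vanish] is degree n + 1 of Ext. *)
Lemma Ext_zeroP n M : Ext_zero n.+1 M N <-> ext_vanish n M.
Proof.
split; last first.
  rewrite -{1}(addn0 n) => /ext_vanish_iter_syzygy vn.
  exists (syzygy_resolution M) => c cc.
  have [_ e1 s1] := pres_exact (pres (syzygy M n.+1)).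
  (* A cocycle vanishes on the image of the next differential, so it factors through the syzygy of
     index n + 1; extending that factor to the preceding projective is what makes it a
     coboundary. *)
  have [|g eg] := lift_epi (f := c) s1.
    by move=> y /(@syzygy_diff_exact0 (syzygy M n.+1) y)[z <-]; apply: cc.
  have [h eh] := vn _ _ _ _ (pres_exact (pres (syzygy M n))) g.
  by exists h => y; rewrite -eg /= eh.
elim: n M => [|n IHn] M [P cP].
  have [K [i ip]] := short_exact_ker (res_aug_surj P).
  have [ii ei _] := ip.
  apply: (ext_vanish_extendable (@res_proj _ _ P 0) ip) => f.
  have [|d ed] := lift_mono (f := res_diff P 0) ii.
    by move=> x; apply/ei/res_exact0; exists x.
  (* Here d corestricts the first differential to the syzygy K, so f d is a 1-cocycle. A cochain b
     bounding it extends f, because every i x is a boundary. *)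
  have [z|b eb] := cP (f \o d : {linear _ -> _}).
    rewrite /= (_ : d _ = 0) ?raddf0 //; apply: ii; rewrite ed raddf0.
    by apply/res_exact; exists z.
  exists b => x.
  have [|y ey] := (@res_exact0 _ _ P (i x)).1; first by apply/ei; exists x.
  by rewrite -ey -eb /=; congr (f _); apply: ii; rewrite ed.
have [K [i ip]] := short_exact_ker (res_aug_surj P).
have [ii ei _] := ip.
apply: (ext_vanish_syzygy (@res_proj _ _ P 0) ip); apply: IHn.
have [|d ed] := lift_mono (f := res_diff P 0) ii.
  by move=> x; apply/ei/res_exact0; exists x.
have d0 y : d y = 0 <-> exists z, res_diff P 1 z = y.
  rewrite -res_exact -ed; split=> [->|e]; first exact: raddf0.
  by apply: ii; rewrite e raddf0.
have sd x : exists y, d y = x.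
  have [|y ey] := (@res_exact0 _ _ P (i x)).1; first by apply/ei; exists x.
  by exists y; apply: ii; rewrite ed.
(* The truncated resolution, with d as its augmentation onto K. *)
exists (@ProjectiveResolution S K (fun i => res_obj P i.+1)
  (fun i => res_diff P i.+1) d (fun i => @res_proj _ _ P i.+1) sd d0
  (fun i => @res_exact _ _ P i.+1)).
exact: cP.
Qed.

End Ext.

(** * Gorenstein projective modules *)

Section FinitelyGenerated.
Variable S : comNzRingType.
Implicit Types A B C M : lmodType S.

Definition submodule M (U : set M) : Prop :=
  U 0 /\ forall a x y, U x -> U y -> U (a *: x + y).

Definition fg_set M (U : set M) : Prop :=
  exists k (g : 'I_k -> M), (forall j, U (g j)) /\
    forall x, U x -> exists a : 'I_k -> S, x = \sum_(j < k) a j *: g j.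

Definition noetherian_module M : Prop :=
  forall U : set M, submodule U -> fg_set U.

Lemma fg_setT M : finitely_generated M <-> fg_set [set: M].
Proof.
split=> [[k [g eg]]|[k [g [_ eg]]]]; exists k, g; first by split.
by move=> x; apply: eg.
Qed.

(** Generators of the part of U in A, together with lifts to U of generators of its image in C.
    Stated for subsets so that it serves both finitely generated modules and the noetherian
    property. *)
Lemma fg_set_extension A B C (i : {linear A -> B}) (p : {linear B -> C})
    (U : set B) :
    short_exact i p -> submodule U ->
    fg_set (fun x => U (i x)) -> fg_set (fun z => exists2 y, U y & p y = z) ->
  fg_set U.
Proof.
move=> ip [U0 UP] [k [g [Ug eg]]] [l [h [Uh eh]]]; have [_ ei _] := ip.
have lh j : exists y, U y /\ p y = h j by have [y] := Uh j; exists y.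
have [h' eh'] := choice lh.
pose G (j : 'I_(k + l)) :=
  match fintype.split j with inl a => i (g a) | inr b => h' b end.
have GE (a : 'I_(k + l) -> S) : \sum_j a j *: G j =
    i (\sum_j a (lshift l j) *: g j) + \sum_j a (rshift k j) *: h' j.
  rewrite big_split_ord linear_sum; congr (_ + _); apply: eq_bigr => j _.
    by rewrite /G (unsplitK (inl j)) linearZ.
  by rewrite /G (unsplitK (inr j)).
exists (k + l)%N, G; split=> [j|y Uy].
  by rewrite /G; case: (fintype.split j) => // b; case: (eh' b).
have [|b eb] := eh (p y); first by exists y.
pose y' := \sum_j b j *: h' j.
have py : p (y - y') = 0.
  rewrite linearB eb /y' linear_sum; apply/eqP; rewrite subr_eq0; apply/eqP.
  by apply: eq_bigr => j _; rewrite linearZ; case: (eh' j) => _ /= ->.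
have Uy' : U y'.
  by rewrite /y'; elim/big_ind: _ => // [u v Uu Uv|j _];
    [rewrite -[u]scale1r | rewrite -[_ *: _]addr0]; apply: UP => //; case: (eh' j).
have [x ex] := (ei _).1 py.
have [|a ea] := eg x.
  by rewrite ex -[y - y']addrC -scaleN1r; apply: UP.
exists (fun j => match fintype.split j with inl c => a c | inr c => b c end).
rewrite GE -[LHS](subrK y') -ex ea; congr (i _ + _); apply: eq_bigr => j _.
  by rewrite (unsplitK (inl j)).
by rewrite (unsplitK (inr j)).
Qed.

Lemma finitely_generated_extension A B C
    (i : {linear A -> B}) (p : {linear B -> C}) :
  short_exact i p -> finitely_generated A -> finitely_generated C ->
  finitely_generated B.
Proof.
move=> ip /fg_setT gA /fg_setT gC; apply/fg_setT.
apply: (fg_set_extension ip) => //.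
have [_ _ sp] := ip; case: gC => k [h [_ eh]]; exists k, h; split=> [j|z _].
  by have [y <-] := sp (h j); exists y.
exact: eh.
Qed.

Lemma finitely_generated_quotient B C (p : {linear B -> C}) :
  (forall z, exists y, p y = z) -> finitely_generated B -> finitely_generated C.
Proof.
move=> sp [k [g eg]]; exists k, (p \o g) => z.
have [y <-] := sp z; have [a ->] := eg y; exists a.
by rewrite linear_sum; apply: eq_bigr => j _; rewrite linearZ.
Qed.

Lemma noetherian_module_extension A B C
    (i : {linear A -> B}) (p : {linear B -> C}) :
  short_exact i p -> noetherian_module A -> noetherian_module C ->
  noetherian_module B.
Proof.
move=> ip nA nC U sU; apply: (fg_set_extension ip sU); case: sU => U0 UP.
  apply: nA; split=> [|a x y Ux Uy]; first by rewrite raddf0.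
  by rewrite linearP; apply: UP.
apply: nC; split=> [|a x y [u Uu <-] [v Uv <-]]; first by exists 0; rewrite ?raddf0.
by exists (a *: u + v); [apply: UP | rewrite linearP].
Qed.

Lemma noetherian_module_fg_sub A B (i : {linear A -> B}) :
  injective i -> noetherian_module B -> finitely_generated A.
Proof.
move=> ii nB.
have [|k [g [Ug eg]]] := nB (fun y => exists x, i x = y).
  split=> [|a _ _ [x <-] [y <-]]; first by exists 0; rewrite raddf0.
  by exists (a *: x + y); rewrite linearP.
have [h eh] := choice Ug; exists k, h => x.
have [|a ea] := eg (i x); first by exists x.
exists a; apply: ii; rewrite ea linear_sum; apply: eq_bigr => j _.
by rewrite linearZ /= eh.
Qed.

End FinitelyGenerated.

(** * Finitely generated free modules as row vectors *)

Section RowVectors.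
Variable S : comNzRingType.

Section RowMap.
Variables (n : nat) (M : lmodType S) (g : 'I_n -> M).
Definition row_fun (x : 'rV[S]_n) : M := \sum_j x 0 j *: g j.
Fact row_fun_is_linear : linear row_fun.
Proof.
move=> a x y; rewrite /row_fun scaler_sumr -big_split; apply: eq_bigr => j _ /=.
by rewrite !mxE scalerDl scalerA.
Qed.
HB.instance Definition _ :=
  GRing.isLinear.Build S 'rV[S]_n M *:%R row_fun row_fun_is_linear.
Definition row_map : {linear 'rV[S]_n -> M} := (row_fun : {linear _ -> _}).

Lemma row_map_delta j : row_map (delta_mx 0 j) = g j.
Proof.
rewrite /= /row_fun (bigD1 j) //= mxE !eqxx scale1r big1 ?addr0 // => k kj.
by rewrite mxE eqxx (negPf kj) scale0r.
Qed.
End RowMap.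

Section RowOf.
Variables (n : nat) (M : lmodType S) (phi : 'I_n -> {linear M -> S^o}).
Definition row_of_fun (x : M) : 'rV[S]_n := \row_j phi j x.
Fact row_of_is_linear : linear row_of_fun.
Proof. by move=> a x y; apply/rowP => j; rewrite !mxE linearP. Qed.
HB.instance Definition _ :=
  GRing.isLinear.Build S M 'rV[S]_n *:%R row_of_fun row_of_is_linear.
Definition row_of : {linear M -> 'rV[S]_n} := (row_of_fun : {linear _ -> _}).

Lemma row_ofE x j : row_of x 0 j = phi j x. Proof. by rewrite mxE. Qed.
End RowOf.

Definition coord_fun n (j : 'I_n) (x : 'rV[S]_n) : S^o := x 0 j.
Fact coord_is_linear n (j : 'I_n) : linear (coord_fun j).
Proof. by move=> a x y; rewrite /coord_fun !mxE. Qed.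
HB.instance Definition _ n (j : 'I_n) :=
  GRing.isLinear.Build S 'rV[S]_n S^o *:%R (coord_fun j) (coord_is_linear j).
Definition coord_map n (j : 'I_n) : {linear 'rV[S]_n -> S^o} :=
  (coord_fun j : {linear _ -> _}).

Lemma row_ext n (M : lmodType S) (f g : {linear 'rV[S]_n -> M}) :
  (forall j, f (delta_mx 0 j) = g (delta_mx 0 j)) -> f =1 g.
Proof.
move=> e x; rewrite [x]row_sum_delta !linear_sum; apply: eq_bigr => j _.
by rewrite !linearZ /= e.
Qed.

Lemma row_projective n : projective_module 'rV[S]_n.
Proof.
move=> A B p g sp; have [a ea] := choice (fun j => sp (g (delta_mx 0 j))).
exists (row_map a); apply: (@row_ext _ _ (p \o row_map a : {linear _ -> _})) => j.
by rewrite -ea -(row_map_delta a).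
Qed.

Lemma finitely_generatedP (M : lmodType S) :
  finitely_generated M <->
  exists n (p : {linear 'rV[S]_n -> M}), forall z, exists y, p y = z.
Proof.
split=> [[k [g eg]]|[n [p sp]]].
  exists k, (row_map g) => z; have [a ->] := eg z; exists (\row_j a j).
  by apply: eq_bigr => j _; rewrite mxE.
exists n, (fun j => p (delta_mx 0 j)) => z; have [y <-] := sp z; exists (y 0).
rewrite {1}[y]row_sum_delta linear_sum; apply: eq_bigr => j _.
by rewrite linearZ.
Qed.

Lemma extendable_row (A B : lmodType S) (i : {linear A -> B}) n :
  extendable S^o i -> extendable 'rV[S]_n i.
Proof.
move=> xi f.
have [h eh] := choice (fun j => xi (coord_map j \o f : {linear _ -> _})).
by exists (row_of h) => x; apply/rowP => j; rewrite row_ofE eh.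
Qed.

Lemma noetherian_row n : noetherian S -> noetherian_module 'rV[S]_n.
Proof.
move=> nS; elim: n => [|n IHn].
  move=> U sU; exists 0%N, (fun _ => 0); split=> [[] //|x _].
  by exists (fun=> 0); rewrite big_ord0; apply/rowP => -[].
have [i' ei'] :
    exists i' : {linear S^o -> 'rV[S]_n.+1}, i' =1 fun a => a *: delta_mx 0 0.
  by apply: linear_of => a x y; rewrite scalerDl scalerA.
pose p := row_of (fun j => coord_map (lift (ord0 : 'I_n.+1) j)).
apply: (@noetherian_module_extension _ _ _ _ i' p _ _ IHn).
  split=> [x y /rowP/(_ 0)|y|z].
  - by rewrite !ei' !mxE !eqxx !mulr1.
  - split=> [/rowP py|[x <-]].
      exists (y 0 0); rewrite ei'; apply/rowP => j; rewrite !mxE eqxx /=.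
      case: (unliftP ord0 j) => [k ->|->]; last by rewrite eqxx mulr1.
      by have := py k; rewrite row_ofE mxE /= /coord_fun mulr0.
    by apply/rowP => j; rewrite row_ofE ei' /= /coord_fun !mxE mulr0.
  - exists (\row_j if unlift ord0 j is Some k then z 0 k else 0).
    by apply/rowP => j; rewrite row_ofE /= /coord_fun mxE liftK.
move=> U [U0 UP]; have [|k [g eg]] := nS U.
  split=> [//|x y Ux Uy|a x Ux]; first by have := UP 1 x y Ux Uy; rewrite scale1r.
  by have := UP a x 0 Ux U0; rewrite addr0.
exists k, g; split=> [j|x /eg[a ->]]; last by exists a.
(* [noetherian] characterizes membership in the ideal, so each generator is seen to lie in U as the
   combination with unit-vector coefficients. *)
apply/eg; exists (fun i => (i == j)%:R).
rewrite (bigD1 j) //= eqxx mul1r big1 ?addr0 // => l lj.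
by rewrite (negPf lj) mul0r.
Qed.

End RowVectors.

(** * Duals, biduality and the five lemma *)

Section Duality.
Variable S : comNzRingType.
Implicit Types A B C F G K M P : lmodType S.

Lemma dual_ext M (phi psi : dual M) :
  (forall x, evaluation x phi = evaluation x psi) -> phi = psi.
Proof. exact: linear_ext. Qed.

Section DualMap.
Variables (A B : lmodType S) (f : {linear A -> B}).
Definition dual_fun (phi : dual B) : dual A :=
  ((phi : {linear B -> S^o}) \o f : {linear A -> S^o}).
Fact dual_fun_is_linear : linear dual_fun.
Proof. by move=> a phi psi; apply: dual_ext. Qed.
HB.instance Definition _ :=
  GRing.isLinear.Build S (dual B) (dual A) *:%R dual_fun dual_fun_is_linear.
Definition dual_map : {linear dual B -> dual A} := (dual_fun : {linear _ -> _}).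
End DualMap.

Fact biduality_is_linear M : linear (@biduality S M).
Proof.
move=> a x y; apply: dual_ext => phi.
exact: (linearP (phi : {linear M -> S^o})).
Qed.
HB.instance Definition _ M :=
  GRing.isLinear.Build S M (dual (dual M)) *:%R (@biduality S M)
    (@biduality_is_linear M).
Definition bidual_map M : {linear M -> dual (dual M)} :=
  (@biduality S M : {linear _ -> _}).

Lemma biduality_natural A B (f : {linear A -> B}) x :
  bidual_map B (f x) = dual_map (dual_map f) (bidual_map A x).
Proof. exact: dual_ext. Qed.

(** Hom(-, S) is left exact; extendability of linear forms along i is the missing surjectivity. *)
Lemma dual_short_exact A B C (i : {linear A -> B}) (p : {linear B -> C}) :
  short_exact i p -> extendable S^o i ->
  short_exact (dual_map p) (dual_map i).
Proof.
move=> ip xi; have pi0 := short_exact0 ip; have [ii ei sp] := ip.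
split=> [phi psi e|phi|phi].
- apply: dual_ext => z; have [y <-] := sp z.
  exact: (congr1 (evaluation y) e).
- split=> [e|[psi <-]].
    have [|psi epsi] := lift_epi (f := phi) sp.
      by move=> y /ei[x <-]; apply: (congr1 (evaluation x) e).
    by exists psi; apply: dual_ext => y; apply: epsi.
  by apply: dual_ext => x; rewrite /= /evaluation /= pi0 raddf0.
- by have [psi e] := xi phi; exists psi; apply: dual_ext => x; apply: e.
Qed.

End Duality.

Section FiveLemma.
Variables (S : comNzRingType) (A B C A' B' C' : lmodType S).
Variables (i : {linear A -> B}) (p : {linear B -> C}).
Variables (i' : {linear A' -> B'}) (p' : {linear B' -> C'}).
Variables (a : {linear A -> A'}) (b : {linear B -> B'}) (c : {linear C -> C'}).
Hypotheses (ip : short_exact i p) (ip' : short_exact i' p').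
Hypotheses (bi : forall x, b (i x) = i' (a x)) (cp : forall y, c (p y) = p' (b y)).

Lemma bijective_inj_surj (X Y : Type) (f : X -> Y) :
  bijective f <-> injective f /\ forall y, exists x, f x = y.
Proof.
split=> [[g fg gf]|[fi fs]];
  first by split=> [|y]; [apply: can_inj fg | exists (g y)].
have [g eg] := choice fs; exists g => // x; exact: fi.
Qed.

Lemma five_lemma : bijective a -> bijective c -> bijective b.
Proof.
move=> /bijective_inj_surj[ai asu] /bijective_inj_surj[ci csu].
have [[ii ei sp] [ii' ei' sp']] := (ip, ip').
apply/bijective_inj_surj; split=> [|y'].
  apply: inj_ker0 => y by0.
  have [|x ex] := (ei y).1; first by apply: ci; rewrite cp by0 !raddf0.
  rewrite -ex (_ : x = 0) ?raddf0 //; apply: ai; apply: ii'.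
  by rewrite -bi ex by0 !raddf0.
have [z ez] := csu (p' y'); have [y ey] := sp z.
have [|x' ex'] := (ei' (y' - b y)).1; first by rewrite linearB -cp ey ez subrr.
have [x ex] := asu x'.
by exists (i x + y); rewrite linearD bi ex ex' subrK.
Qed.

Lemma five_lemma_kernel : bijective b -> bijective c -> bijective a.
Proof.
move=> /bijective_inj_surj[bj bs] /bijective_inj_surj[ci _].
have [[ii ei sp] [ii' ei' sp']] := (ip, ip').
apply/bijective_inj_surj; split=> [x y /(congr1 i')|x'].
  by rewrite -!bi => /bj/ii.
have [y ey] := bs (i' x').
have [|x ex] := (ei y).1.
  by apply: ci; rewrite cp ey (short_exact0 ip') raddf0.
by exists x; apply: ii'; rewrite -bi ex.
Qed.

Lemma five_lemma_cokernel : bijective a -> bijective b -> bijective c.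
Proof.
move=> /bijective_inj_surj[_ asu] /bijective_inj_surj[bj bs].
have [[ii ei sp] [ii' ei' sp']] := (ip, ip').
apply/bijective_inj_surj; split=> [|z'].
  apply: inj_ker0 => z; have [y <-] := sp z; rewrite cp => /ei'[x' ex'].
  have [x ex] := asu x'; apply/ei; exists x.
  by apply: bj; rewrite bi ex.
have [y' <-] := sp' z'; have [y <-] := bs y'.
by exists (p y); rewrite cp.
Qed.
End FiveLemma.

Section GorensteinProjective.
Variable S : comNzRingType.
Implicit Types A B C F G K M P : lmodType S.

Lemma gorenstein_projectiveP M :
  gorenstein_projective M <->
  [/\ finitely_generated M, forall n, ext_vanish S^o n M,
      forall n, ext_vanish S^o n (dual M) & bijective (bidual_map M)].
Proof.
split=> [[fg e ed b]|[fg e ed b]].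
  by split=> // n; apply/Ext_zeroP; [apply: e | apply: ed].
by split=> // -[//|n] _; apply/Ext_zeroP.
Qed.

(** Ext^1(C, S) = 0 keeps the sequence exact after one dualization and Ext^1 of [dual A] after the
    second, so the five lemma compares B with its bidual. *)
Lemma gp_extension A B C (i : {linear A -> B}) (p : {linear B -> C}) :
  short_exact i p -> gorenstein_projective A -> gorenstein_projective C ->
  gorenstein_projective B.
Proof.
move=> ip /gorenstein_projectiveP[fA eA dA bA] /gorenstein_projectiveP[fC eC dC bC].
have dip := dual_short_exact ip (eC 0%N _ _ _ _ ip).
have ddip := dual_short_exact dip (dA 0%N _ _ _ _ dip).
apply/gorenstein_projectiveP; split=> [|n|n|].
- exact: (finitely_generated_extension ip).
- exact: (ext_vanish_extension ip).
- exact: (ext_vanish_extension dip).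
- exact: (five_lemma ip ddip (biduality_natural i) (biduality_natural p)).
Qed.

Lemma gp_extendable A B C (i : {linear A -> B}) (p : {linear B -> C}) :
  short_exact i p -> gorenstein_projective C -> extendable S^o i.
Proof.
by move=> ip /gorenstein_projectiveP[_ e _ _]; apply: (e 0%N _ _ _ _ ip).
Qed.

Lemma dual_row_decomposition n (phi : dual 'rV[S]_n) :
  phi = \sum_j evaluation (delta_mx 0 j) phi *: (coord_map S j : dual 'rV[S]_n).
Proof.
apply: linear_ext; apply: row_ext => j.
rewrite -[RHS]/(evaluation (delta_mx 0 j) _) linear_sum (bigD1 j) //= big1 ?addr0.
  by rewrite /evaluation /coord_fun mxE !eqxx [RHS]mulr1.
move=> k kj; rewrite /coord_fun mxE eqxx (negPf kj).
exact: mulr0.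
Qed.

Lemma dual_row_projective n : projective_module (dual 'rV[S]_n).
Proof.
move=> A B p g sp.
have [a ea] := choice (fun j => sp (g (coord_map S j : dual 'rV[S]_n))).
have [|h eh] := @linear_of S (dual 'rV[S]_n) A
  (fun phi => \sum_j evaluation (delta_mx 0 j) phi *: a j).
  move=> s phi psi; rewrite scaler_sumr -big_split; apply: eq_bigr => j _.
  by rewrite linearP scalerDl -scalerA.
exists h => phi; rewrite eh [in RHS](dual_row_decomposition phi) !linear_sum.
by apply: eq_bigr => j _; rewrite !linearZ /= ea.
Qed.

Lemma gp_row n : gorenstein_projective 'rV[S]_n.
Proof.
apply/gorenstein_projectiveP; split=> [|k|k|].
- by apply/finitely_generatedP; exists n, idfun => z; exists z.
- exact/ext_vanish_projective/row_projective.
- exact/ext_vanish_projective/dual_row_projective.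
apply/bijective_inj_surj; split=> [x y e|Phi].
  apply/rowP => j.
  exact: (congr1 (evaluation (coord_map S j : dual 'rV[S]_n)) e).
exists (\row_j evaluation (coord_map S j : dual 'rV[S]_n) Phi).
apply: dual_ext => phi; rewrite (dual_row_decomposition phi).
rewrite /evaluation !linear_sum; apply: eq_bigr => j _; rewrite !linearZ /=.
by rewrite /evaluation /= /coord_fun mxE.
Qed.

(** Dualizing presents [dual K] as the quotient of a free module by [dual M], which shifts the
    vanishing of Ext from [dual M] to degrees at least 2 for [dual K]. Degree 1 comes from the
    surjectivity of biduality for M. *)
Lemma gp_syzygy n K M (i : {linear K -> 'rV[S]_n}) (p : {linear 'rV[S]_n -> M}) :
  noetherian S -> short_exact i p -> gorenstein_projective M ->
  gorenstein_projective K.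
Proof.
move=> nS ip /gorenstein_projectiveP[fM eM dM bM]; have [ii ei sp] := ip.
have dip := dual_short_exact ip (eM 0%N _ _ _ _ ip).
have PP := @row_projective S n; have PdP := @dual_row_projective n.
have dK k : ext_vanish S^o k (dual K).
  case: k => [|k]; last exact: (ext_vanish_syzygy PdP dip).
  apply: (ext_vanish_extendable PdP dip) => f.
  (* A form on [dual M] is evaluation at some m in M; evaluation at a preimage x of m in the free
     module extends it. *)
  have /bijective_inj_surj[_ sM] := bM; have [m em] := sM f; have [x ex] := sp m.
  by exists (bidual_map _ x) => phi; rewrite -em -ex.
apply/gorenstein_projectiveP; split=> [|k||].
- exact: (noetherian_module_fg_sub ii (@noetherian_row S n nS)).
- exact: (eM k.+1 _ _ _ _ PP ip).
- exact: dK.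
have /gorenstein_projectiveP[_ _ _ bP] := gp_row n.
have ddip := dual_short_exact dip (dK 0%N _ _ _ _ dip).
exact: (five_lemma_kernel ip ddip (biduality_natural i)
  (biduality_natural p) bP bM).
Qed.

(** The extendability hypothesis gives Ext^1(C, S) = 0 and makes [dual C] a syzygy of [dual G];
    everything else is dimension shifting and the five lemma. *)
Lemma gp_cosyzygy n G C (i : {linear G -> 'rV[S]_n}) (p : {linear 'rV[S]_n -> C}) :
  short_exact i p -> extendable S^o i -> gorenstein_projective G ->
  gorenstein_projective C.
Proof.
move=> ip xi /gorenstein_projectiveP[fG eG dG bG]; have [ii ei sp] := ip.
have dip := dual_short_exact ip xi.
have PP := @row_projective S n; have PdP := @dual_row_projective n.
have ddip := dual_short_exact dip (dG 0%N _ _ _ _ dip).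
have /gorenstein_projectiveP[fP _ _ bP] := gp_row n.
apply/gorenstein_projectiveP; split=> [|[|k]|k|].
- exact: (finitely_generated_quotient sp).
- exact: (ext_vanish_extendable PP ip).
- exact: (ext_vanish_syzygy PP ip).
- exact: (dG k.+1 _ _ _ _ PdP dip).
- exact: (five_lemma_cokernel ip ddip (biduality_natural i)
    (biduality_natural p) bG bP).
Qed.

Lemma gp_torsionless M (x : M) : gorenstein_projective M ->
  (forall phi : {linear M -> S^o}, phi x = 0) -> x = 0.
Proof.
case=> _ _ _ /bij_inj bi e; apply: bi; apply: dual_ext => phi.
by rewrite [RHS](raddf0 (phi : {linear M -> S^o})); apply: e.
Qed.

Lemma gp_cover M : noetherian S -> gorenstein_projective M ->
  exists n K (i : {linear K -> 'rV[S]_n}) (p : {linear 'rV[S]_n -> M}),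
    short_exact i p /\ gorenstein_projective K.
Proof.
move=> nS gM; have /finitely_generatedP[n [p sp]] := gp_fg gM.
have [K [i ip]] := short_exact_ker sp.
by exists n, K, i, p; split=> //; apply: (gp_syzygy nS ip gM).
Qed.

(* Generators phi_j of the dual of G embed G by x |-> (phi_j x)_j; every linear
   form on G, being a combination of the phi_j, extends along this embedding. *)
Lemma gp_embed G : noetherian S -> gorenstein_projective G ->
  exists n C (i : {linear G -> 'rV[S]_n}) (p : {linear 'rV[S]_n -> C}),
    short_exact i p /\ gorenstein_projective C.
Proof.
move=> nS gG; have /finitely_generatedP[m [q sq]] := gp_fg gG.
(* Evaluation at m generators of G embeds its dual in the noetherian module S^m. *)
have : finitely_generated (dual G).
  apply: (@noetherian_module_fg_sub _ _ _
    (row_of (fun j => biduality (q (delta_mx 0 j)) : {linear dual G -> S^o})));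
    last exact: @noetherian_row S m nS.
  move=> phi psi /rowP e; apply: linear_ext => x; have [y <-] := sq x.
  apply: (@row_ext _ _ _ ((phi : {linear G -> S^o}) \o q : {linear _ -> _})
    ((psi : {linear G -> S^o}) \o q : {linear _ -> _})) => j.
  by have := e j; rewrite !row_ofE.
case=> n [phi ephi]; pose i := row_of (phi : 'I_n -> {linear G -> S^o}).
have xi : extendable S^o i.
  move=> f; have [a ea] := ephi f; exists (row_map (a : 'I_n -> S^o)) => x.
  rewrite -[RHS]/(evaluation x _) ea linear_sum; apply: eq_bigr => j _.
  by rewrite linearZ row_ofE; apply: mulrC.
have ii : injective i.
  apply: inj_ker0 => x ix; apply: (gp_torsionless gG) => f.
  by have [h eh] := xi f; rewrite -eh ix raddf0.
have [C [p ip]] := short_exact_coker ii.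
by exists n, C, i, p; split=> //; apply: (gp_cosyzygy ip xi gG).
Qed.

End GorensteinProjective.

(** * Monomorphisms and epimorphisms with Gorenstein projective cokernel or kernel *)

Section Admissible.
Variable S : comNzRingType.
Implicit Types A B C D E F K L M Q : lmodType S.

Definition adm_mono A B (i : {linear A -> B}) : Prop :=
  exists C (p : {linear B -> C}), short_exact i p /\ gorenstein_projective C.

Definition adm_epi B C (p : {linear B -> C}) : Prop :=
  exists A (i : {linear A -> B}), short_exact i p /\ gorenstein_projective A.

Lemma row0_eq0 (x : 'rV[S]_0) : x = 0.
Proof. by apply/rowP => -[]. Qed.

Lemma adm_mono_id A : adm_mono (idfun : {linear A -> A}).
Proof.
exists 'rV[S]_0, \0; split; last exact: gp_row.
by split=> [//|y|z]; [split=> // _; exists y | exists 0; rewrite [z]row0_eq0].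
Qed.

Lemma adm_epi_id A : adm_epi (idfun : {linear A -> A}).
Proof.
exists 'rV[S]_0, \0; split; last exact: gp_row.
split=> [x y _|y|z]; [by rewrite [x]row0_eq0 [y]row0_eq0| |by exists z].
by split=> [/= ->|[x <-] //]; exists 0.
Qed.

(** C/A is an extension of C/B by B/A, hence Gorenstein projective. *)
Lemma adm_mono_comp A B C (i : {linear A -> B}) (j : {linear B -> C}) :
  adm_mono i -> adm_mono j -> adm_mono (j \o i : {linear _ -> _}).
Proof.
move=> [D [p [ip gD]]] [E [q [jq gE]]].
have pi0 := short_exact0 ip; have qj0 := short_exact0 jq.
have [ii ei sp] := ip; have [ij ej sq] := jq.
have [|F [r jir]] := @short_exact_coker _ _ _ (j \o i : {linear _ -> _}).
  by move=> x y /ij/ii.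
have r0 := short_exact0 jir; have [_ er sr] := jir.
have [|t et] := lift_epi (f := q) sr; first by move=> y /er[x <-]; apply: qj0.
have [|s es] := lift_epi (f := (r \o j : {linear _ -> _})) sp.
  by move=> y /ei[x <-]; apply: r0.
exists F, r; split=> //; apply: (gp_extension (i := s) (p := t)) gD gE; split.
- apply: inj_ker0 => d; have [y <-] := sp d; rewrite es => /er[x] /= /ij <-.
  exact: pi0.
- move=> f; have [c <-] := sr f; rewrite et; split=> [/ej[y <-]|[d]].
    by exists (p y); rewrite es.
  have [y <-] := sp d; rewrite es /= => e; rewrite -et -e et; exact: qj0.
- by move=> e; have [c <-] := sq e; exists (r c).
Qed.

Lemma adm_epi_comp A B C (p : {linear A -> B}) (q : {linear B -> C}) :
  adm_epi p -> adm_epi q -> adm_epi (q \o p : {linear _ -> _}).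
Proof.
move=> [K [k [kp gK]]] [L [l [lq gL]]].
have [M [e [u [v [se uv _ _]]]]] := kernel_comp_short_exact kp lq.
by exists M, e; split=> //; apply: gp_extension uv gK gL.
Qed.

Lemma adm_mono_opp A B (i : {linear A -> B}) :
  adm_mono i -> adm_mono (\- i : {linear _ -> _}).
Proof.
move=> [C [p [[ii ei sp] gC]]]; exists C, p; split=> //; split=> // [x y|y].
  by move/oppr_inj/ii.
apply: iff_trans (ei y) _.
by split=> -[x <-]; exists (- x); rewrite /= raddfN ?opprK.
Qed.

(** The cokernel Q of (f, i) is the pushout of i along f up to sign, so A' -> Q has the same
    cokernel C as i. The sign is restored by applying this to the opposite of the inflation. *)
Lemma pushout_short_exact A B C A' Q (i : {linear A -> B}) (p : {linear B -> C})
    (f : {linear A -> A'}) (q : {linear (A' * B)%type -> Q}) :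
    short_exact i p -> short_exact (lpair f i) q ->
  exists r : {linear Q -> C},
    short_exact (q \o lpair idfun \0 : {linear _ -> _}) r.
Proof.
move=> ip jq; have pi0 := short_exact0 ip; have q0 := short_exact0 jq.
have [ii ei sp] := ip; have [ij ej sq] := jq.
have [|r er] := lift_epi (f := (p \o snd : {linear _ -> _})) sq.
  by move=> y /ej[x <-]; apply: pi0.
exists r; split.
- apply: inj_ker0 => a /ej[x] /= [<-]; rewrite -(raddf0 i) => /ii ->.
  exact: raddf0.
- move=> z; have [[a b] <-] := sq z; rewrite er /=; split=> [/ei[x <-]|[a' e]].
    (* Modulo the relation (f x, i x), the pair (a, i x) equals (a - f x, 0). *)
    exists (a - f x); have := q0 x; rewrite -[in X in _ -> X](addr0 (q (a, _))).
    move/(congr1 -%R); rewrite oppr0 => <-; rewrite -linearB /=.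
    by congr (q (_, _)); rewrite /= ?subrr.
  have /ej[x] : q (a' - a, - b) = 0.
    have -> : (a' - a, - b) = (a', 0) - (a, b) by congr (_, _); rewrite /= sub0r.
    by rewrite linearB -e subrr.
  case=> _ /(congr1 -%R); rewrite opprK => <-; rewrite linearN pi0; exact: oppr0.
- by move=> c; have [b <-] := sp c; exists (q (0, b)); rewrite er.
Qed.

Lemma adm_mono_pair A B A' (i : {linear A -> B}) (f : {linear A -> A'}) :
  adm_mono i -> gorenstein_projective A' -> adm_mono (lpair f i).
Proof.
move=> [C [p [ip gC]]] gA'; have [ii _ _] := ip.
have [|Q [q jq]] := @short_exact_coker _ _ _ (lpair f i);
  first by move=> x y [_ /ii].
have [r sr] := pushout_short_exact ip jq.
by exists Q, q; split=> //; apply: gp_extension sr gA' gC.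
Qed.

Lemma pushout_adm_mono A B A' Q (i : {linear A -> B}) (f : {linear A -> A'})
    (q : {linear (A' * B)%type -> Q}) :
  adm_mono i -> short_exact (lpair f i) q ->
  adm_mono (q \o lpair idfun \0 : {linear _ -> _}).
Proof.
move=> [C [p [ip gC]]] jq; have [r sr] := pushout_short_exact ip jq.
by exists C, r.
Qed.

Lemma pullback_adm_epi B C D K (p : {linear B -> C}) (f : {linear D -> C})
    (k : {linear K -> (B * D)%type}) :
  adm_epi p -> short_exact k (lcopair p f) ->
  adm_epi (snd \o k : {linear _ -> _}).
Proof.
move=> [A [i [ip gA]]].
have -> : f = \- (\- f : {linear _ -> _}).
  by apply: linear_ext => x /=; rewrite opprK.
move=> [ik ek _]; have pb := lpullback_ker ik ek.
by have [j [sj _]] := lpullback_short_exact pb ip; exists A, j.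
Qed.

Lemma adm_epi_copair B C D (p : {linear B -> C}) (f : {linear D -> C}) :
  adm_epi p -> gorenstein_projective D -> adm_epi (lcopair p f).
Proof.
move=> ap gD; have [A [i [[_ _ sp] _]]] := ap.
have [z|K [k sk]] := short_exact_ker (p := lcopair p f).
  by have [y <-] := sp z; exists (y, 0); rewrite /= raddf0 addr0.
have [L [l [sl gL]]] := pullback_adm_epi ap sk.
by exists K, k; split=> //; apply: gp_extension sl gL gD.
Qed.

Lemma adm_mono_iso A B B' (i : {linear A -> B}) (s : {linear B -> B'})
    (t : {linear B' -> B}) :
  cancel s t -> cancel t s -> adm_mono i -> adm_mono (s \o i : {linear _ -> _}).
Proof.
move=> st ts ai; apply: adm_mono_comp => //.
exists 'rV[S]_0, \0; split; last exact: gp_row.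
split=> [|y|z]; first exact: can_inj st.
  by split=> // _; exists (t y).
by exists 0; rewrite [z]row0_eq0.
Qed.

Lemma adm_epi_iso A B B' (p : {linear B -> A}) (s : {linear B' -> B})
    (t : {linear B -> B'}) :
  cancel s t -> cancel t s -> adm_epi p -> adm_epi (p \o s : {linear _ -> _}).
Proof.
move=> st ts ap; apply: adm_epi_comp => //.
exists 'rV[S]_0, \0; split; last exact: gp_row.
split=> [x y _|y|z]; [by rewrite [x]row0_eq0 [y]row0_eq0| |by exists (t z)].
split=> [|[x <-]]; last exact: raddf0.
by rewrite -(raddf0 s) => /(can_inj st) ->; exists 0.
Qed.

(** In the embedding into [mf_free] the known monomorphism is the first coordinate of one component
    and the second of the other, so both orders are needed. *)
Lemma adm_mono_pair_swap A B A' (i : {linear A -> B}) (f : {linear A -> A'}) :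
  adm_mono i -> gorenstein_projective A' -> adm_mono (lpair i f).
Proof.
move=> ai gA'.
have := adm_mono_iso (s := lpair snd fst) (t := lpair snd fst) _ _
  (adm_mono_pair f ai gA').
rewrite (_ : _ \o _ = lpair i f :> {linear _ -> _}); last exact: linear_ext.
by apply; case.
Qed.

Lemma adm_epi_copair_swap B C D (p : {linear B -> C}) (f : {linear D -> C}) :
  adm_epi p -> gorenstein_projective D -> adm_epi (lcopair f p).
Proof.
move=> ap gD.
have := adm_epi_iso (s := lpair snd fst) (t := lpair snd fst) _ _
  (adm_epi_copair f ap gD).
rewrite (_ : _ \o _ = lcopair f p :> {linear _ -> _}); last first.
  by apply: linear_ext => x /=; rewrite addrC.
by apply; case.
Qed.

Lemma gp_prod A B : gorenstein_projective A -> gorenstein_projective B ->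
  gorenstein_projective (A * B)%type.
Proof.
move=> gA gB; apply: (gp_extension (i := lpair idfun \0) (p := snd)) gA gB.
split=> [x y [] //|[a b]|b]; last by exists (0, b).
by split=> [/= ->|[x /= [_ <-]] //]; exists a.
Qed.

Lemma short_exact_iso A B C A' B' C' (i : {linear A -> B}) (p : {linear B -> C})
    (i' : {linear A' -> B'}) (p' : {linear B' -> C'})
    (a : A -> A') (b : {linear B -> B'}) (c : {linear C -> C'}) :
    bijective a -> bijective b -> bijective c ->
    (forall x, b (i x) = i' (a x)) -> (forall y, c (p y) = p' (b y)) ->
  short_exact i p -> short_exact i' p'.
Proof.
move=> /bijective_inj_surj[_ sa] /bijective_inj_surj[bj sb].
move=> /bijective_inj_surj[cj sc] bi cp ip.
have [ii ei sp] := ip; split.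
- move=> x y; have [u <-] := sa x; have [v <-] := sa y.
  by rewrite -!bi => /bj/ii ->.
- move=> y'; have [y <-] := sb y'; rewrite -cp; split=> [cpy|[x']].
    have /ei[x <-] : p y = 0 by apply: cj; rewrite cpy raddf0.
    by exists (a x); rewrite bi.
  have [x <-] := sa x'; rewrite -bi => /bj <-.
  by rewrite (short_exact0 ip) raddf0.
- move=> z'; have [z <-] := sc z'; have [y <-] := sp z.
  by exists (b y); rewrite cp.
Qed.

End Admissible.

(** * Matrix factorizations form a Frobenius category *)

Section Retracts.
Variable E : conflation_category.

Lemma projective_object_retract (X P : E) (s : hom X P) (r : hom P X) :
  r \oc s = idm X -> projective_object P -> projective_object X.
Proof.
move=> rs PP A B p g dp; have [h eh] := PP _ _ p (g \oc r) dp.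
by exists (h \oc s); rewrite compA eh -compA rs compm1.
Qed.

Lemma injective_object_retract (X I : E) (s : hom X I) (r : hom I X) :
  r \oc s = idm X -> injective_object I -> injective_object X.
Proof.
move=> rs II A B i g di; have [h eh] := II _ _ i (s \oc g) di.
by exists (r \oc h); rewrite -compA eh compA rs comp1m.
Qed.

End Retracts.

Section MatrixFactorizations.
Variables (S : comNzRingType) (w : S).
Implicit Types X Y Z W : MF w.

Section HomOf.
Variables (X Y : MF w).
Variables (f1 : {linear mf1 X -> mf1 Y}) (f0 : {linear mf0 X -> mf0 Y}).
Hypothesis c1 : forall x, mf_map1 Y (f1 x) = f0 (mf_map1 X x).
Hypothesis c0 : forall x, mf_map0 Y (f0 x) = f1 (mf_map0 X x).

Fact mf_hom_of_subproof : (f1, f0) \in @mf_commutes S w X Y.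
Proof. exact/asboolP. Qed.
Definition mf_hom_of : hom X Y := MFHom mf_hom_of_subproof.
End HomOf.

Definition mfc1 X Y (f : hom X Y) : {linear mf1 X -> mf1 Y} := (f : mf_hom X Y).1.
Definition mfc0 X Y (f : hom X Y) : {linear mf0 X -> mf0 Y} := (f : mf_hom X Y).2.

Lemma mf_comm1 X Y (f : hom X Y) x : mf_map1 Y (mfc1 f x) = mfc0 f (mf_map1 X x).
Proof. by have /asboolP[e _] := mf_homP (f : mf_hom X Y); apply: e. Qed.

Lemma mf_comm0 X Y (f : hom X Y) x : mf_map0 Y (mfc0 f x) = mfc1 f (mf_map0 X x).
Proof. by have /asboolP[_ e] := mf_homP (f : mf_hom X Y); apply: e. Qed.

Lemma mf_ext X Y (f g : hom X Y) :
  (forall x, mfc1 f x = mfc1 g x) -> (forall x, mfc0 f x = mfc0 g x) -> f = g.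
Proof. exact: mf_hom_ext. Qed.

Lemma mf_eqP X Y (f g : hom X Y) : f = g ->
  (forall x, mfc1 f x = mfc1 g x) /\ (forall x, mfc0 f x = mfc0 g x).
Proof. by move=> ->. Qed.

(** The structure maps of Y descend to the cokernels of the two components, and the relations with w
    descend with them by surjectivity. Inflations can thus be recognized one component at a time. *)
Lemma mf_inflationP X Y (i : hom X Y) :
  inflation (E := MF w) i <-> adm_mono (mfc1 i) /\ adm_mono (mfc0 i).
Proof.
split=> [[Z [p [s1 s0]]]|[[C1 [p1 [s1 g1]]] [C0 [p0 [s0 g0]]]]].
  by split; [exists (mf1 Z), (mfc1 p) | exists (mf0 Z), (mfc0 p)];
    split=> //; [apply: mf1_gp | apply: mf0_gp].
have [[_ e1 q1] [_ e0 q0]] := (s1, s0).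
have [|m1 em1] := lift_epi (f := (p0 \o mf_map1 Y : {linear _ -> _})) q1.
  by move=> y /e1[x <-]; rewrite /= mf_comm1 (short_exact0 s0).
have [|m0 em0] := lift_epi (f := (p1 \o mf_map0 Y : {linear _ -> _})) q0.
  by move=> y /e0[x <-]; rewrite /= mf_comm0 (short_exact0 s1).
have m10 z : m1 (m0 z) = w *: z.
  by have [y <-] := q0 z; rewrite em0 em1 /= mf_map10 linearZ.
have m01 z : m0 (m1 z) = w *: z.
  by have [y <-] := q1 z; rewrite em1 em0 /= mf_map01 linearZ.
exists (MFObject g1 g0 m10 m01).
by exists (@mf_hom_of Y (MFObject g1 g0 m10 m01) p1 p0 em1 em0).
Qed.

Lemma mf_deflationP Y Z (p : hom Y Z) :
  deflation (E := MF w) p <-> adm_epi (mfc1 p) /\ adm_epi (mfc0 p).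
Proof.
split=> [[X [i [s1 s0]]]|[[K1 [i1 [s1 g1]]] [K0 [i0 [s0 g0]]]]].
  by split; [exists (mf1 X), (mfc1 i) | exists (mf0 X), (mfc0 i)];
    split=> //; [apply: mf1_gp | apply: mf0_gp].
have [[j1 e1 _] [j0 e0 _]] := (s1, s0).
have [|m1 em1] := lift_mono (f := (mf_map1 Y \o i1 : {linear _ -> _})) j0.
  by move=> x; apply/e0; rewrite /= -mf_comm1 (short_exact0 s1) raddf0.
have [|m0 em0] := lift_mono (f := (mf_map0 Y \o i0 : {linear _ -> _})) j1.
  by move=> x; apply/e1; rewrite /= -mf_comm0 (short_exact0 s0) raddf0.
have m10 x : m1 (m0 x) = w *: x.
  by apply: j0; rewrite em1 /= em0 /= mf_map10 linearZ.
have m01 x : m0 (m1 x) = w *: x.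
  by apply: j1; rewrite em0 /= em1 /= mf_map01 linearZ.
exists (MFObject g1 g0 m10 m01).
by exists (@mf_hom_of (MFObject g1 g0 m10 m01) Y i1 i0 (fun x => esym (em1 x))
  (fun x => esym (em0 x))).
Qed.

Definition mf_zero : MF w.
Proof.
refine (@MFObject S w 'rV[S]_0 'rV[S]_0 \0 \0 (gp_row S 0) (gp_row S 0) _ _);
by move=> x; rewrite [RHS]row0_eq0.
Defined.

Section Sum.
Variables X Y : MF w.
Definition mf_sum : MF w.
Proof.
refine (@MFObject S w (mf1 X * mf1 Y)%type (mf0 X * mf0 Y)%type
  (lpair (mf_map1 X \o fst : {linear _ -> _})
         (mf_map1 Y \o snd : {linear _ -> _}))
  (lpair (mf_map0 X \o fst : {linear _ -> _})
         (mf_map0 Y \o snd : {linear _ -> _}))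
  (gp_prod (mf1_gp X) (mf1_gp Y)) (gp_prod (mf0_gp X) (mf0_gp Y)) _ _);
case=> x y; by rewrite /= /pair_fun /= ?mf_map10 ?mf_map01.
Defined.

Definition mf_pair W (f : hom W X) (g : hom W Y) : hom W mf_sum.
Proof.
refine (@mf_hom_of W mf_sum
  (lpair (mfc1 f) (mfc1 g)) (lpair (mfc0 f) (mfc0 g)) _ _);
by move=> x; rewrite /= /pair_fun /= ?mf_comm1 ?mf_comm0.
Defined.

Definition mf_copair W (f : hom X W) (g : hom Y W) : hom mf_sum W.
Proof.
refine (@mf_hom_of mf_sum W
  (lcopair (mfc1 f) (mfc1 g)) (lcopair (mfc0 f) (mfc0 g)) _ _);
by move=> x; rewrite /= linearD ?mf_comm1 ?mf_comm0.
Defined.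

Definition mf_inl : hom X mf_sum := mf_pair (idm X) 0.
Definition mf_inr : hom Y mf_sum := mf_pair 0 (idm Y).
Definition mf_fst : hom mf_sum X := mf_copair (idm X) 0.
Definition mf_snd : hom mf_sum Y := mf_copair 0 (idm Y).

Lemma mf_sum_ext W (g h : hom mf_sum W) :
  g \oc mf_inl = h \oc mf_inl -> g \oc mf_inr = h \oc mf_inr -> g = h.
Proof.
move=> /mf_eqP[l1 l0] /mf_eqP[r1 r0]; apply: mf_ext => -[x y].
  have -> : (x, y) = (x, 0) + (0, y) by congr (_, _); rewrite /= ?addr0 ?add0r.
  rewrite !linearD; congr (_ + _); [exact: l1 | exact: r1].
have -> : (x, y) = (x, 0) + (0, y) by congr (_, _); rewrite /= ?addr0 ?add0r.
by rewrite !linearD; congr (_ + _); [exact: l0 | exact: r0].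
Qed.

Lemma mf_copair_inl W (f : hom X W) (g : hom Y W) :
  mf_copair f g \oc mf_inl = f.
Proof. by apply: mf_ext => x; rewrite /= raddf0 addr0. Qed.

Lemma mf_copair_inr W (f : hom X W) (g : hom Y W) :
  mf_copair f g \oc mf_inr = g.
Proof. by apply: mf_ext => x; rewrite /= raddf0 add0r. Qed.

Lemma mf_fst_pair W (f : hom W X) (g : hom W Y) : mf_fst \oc mf_pair f g = f.
Proof. by apply: mf_ext => x; rewrite /= addr0. Qed.

Lemma mf_snd_pair W (f : hom W X) (g : hom W Y) : mf_snd \oc mf_pair f g = g.
Proof. by apply: mf_ext => x; rewrite /= add0r. Qed.

Lemma mf_pairE W (f : hom W X) (g : hom W Y) :
  mf_pair f g = mf_inl \oc f + mf_inr \oc g.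
Proof.
apply: mf_ext => x.
  transitivity (mfc1 f x + 0, 0 + mfc1 g x); last by [].
  by rewrite addr0 add0r.
transitivity (mfc0 f x + 0, 0 + mfc0 g x); last by [].
by rewrite addr0 add0r.
Qed.

Lemma mf_sum_id : mf_inl \oc mf_fst + mf_inr \oc mf_snd = idm mf_sum.
Proof.
apply: mf_sum_ext; rewrite compDm -!compA !comp1m.
  by rewrite mf_fst_pair mf_snd_pair compm1 compm0 addr0.
by rewrite mf_fst_pair mf_snd_pair compm1 compm0 add0r.
Qed.

End Sum.

Lemma mf_is_kernel X Y Z (i : hom X Y) (p : hom Y Z) :
  conflation (c := MF w) i p -> is_kernel i p.
Proof.
move=> [s1 s0]; have [[j1 e1 _] [j0 e0 _]] := (s1, s0); split.
  by apply: mf_ext; [apply: (short_exact0 s1) | apply: (short_exact0 s0)].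
move=> W g /mf_eqP[g1 g0].
have [|h1 eh1] := lift_mono (f := mfc1 g) j1; first by move=> x; apply/e1/g1.
have [|h0 eh0] := lift_mono (f := mfc0 g) j0; first by move=> x; apply/e0/g0.
have c1 x : mf_map1 X (h1 x) = h0 (mf_map1 W x).
  by apply: j0; rewrite -mf_comm1 eh1 eh0 mf_comm1.
have c0 x : mf_map0 X (h0 x) = h1 (mf_map0 W x).
  by apply: j1; rewrite -mf_comm0 eh1 eh0 mf_comm0.
exists (mf_hom_of c1 c0); split; first exact: mf_ext.
by move=> h /mf_eqP[d1 d0]; apply: mf_ext => x; [apply: j1 | apply: j0];
  rewrite ?eh1 ?eh0; symmetry; [apply: d1 | apply: d0].
Qed.

Lemma mf_is_cokernel X Y Z (i : hom X Y) (p : hom Y Z) :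
  conflation (c := MF w) i p -> is_cokernel i p.
Proof.
move=> [s1 s0]; have [[_ e1 p1] [_ e0 p0]] := (s1, s0); split.
  by apply: mf_ext; [apply: (short_exact0 s1) | apply: (short_exact0 s0)].
move=> W g /mf_eqP[g1 g0].
have [|h1 eh1] := lift_epi (f := mfc1 g) p1; first by move=> y /e1[x <-]; apply/g1.
have [|h0 eh0] := lift_epi (f := mfc0 g) p0; first by move=> y /e0[x <-]; apply/g0.
have c1 z : mf_map1 W (h1 z) = h0 (mf_map1 Z z).
  by have [y <-] := p1 z; rewrite mf_comm1 eh1 eh0 mf_comm1.
have c0 z : mf_map0 W (h0 z) = h1 (mf_map0 Z z).
  by have [y <-] := p0 z; rewrite mf_comm0 eh1 eh0 mf_comm0.
exists (mf_hom_of c1 c0); split; first exact: mf_ext.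
move=> h /mf_eqP[d1 d0]; apply: mf_ext => z.
  by have [y <-] := p1 z; rewrite [LHS]eh1; symmetry; apply: d1.
by have [y <-] := p0 z; rewrite [LHS]eh0; symmetry; apply: d0.
Qed.

Lemma mf_iso_bijective X Y (f : hom X Y) :
  is_iso f -> bijective (mfc1 f) /\ bijective (mfc0 f).
Proof.
move=> [g [/mf_eqP[a1 a0] /mf_eqP[b1 b0]]].
by split; [exists (mfc1 g) | exists (mfc0 g)].
Qed.

Lemma mf_exact : is_exact (MF w).
Proof.
split.
- by exists mf_zero; apply: mf_ext => x; rewrite [LHS]row0_eq0 [RHS]row0_eq0.
- move=> X Y; exists (mf_sum X Y), (mf_inl X Y), (mf_inr X Y).
  exists (mf_fst X Y), (mf_snd X Y); split; last exact: mf_sum_id.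
  + exact: mf_fst_pair.
  + exact: mf_snd_pair.
  + exact: mf_fst_pair.
  + exact: mf_snd_pair.
- exact: mf_is_kernel.
- exact: mf_is_cokernel.
- move=> X Y Z X' Y' Z' i p i' p' a b c.
  move=> /mf_iso_bijective[a1 a0] /mf_iso_bijective[b1 b0] /mf_iso_bijective[c1 c0].
  move=> /mf_eqP[bi1 bi0] /mf_eqP[cp1 cp0] [s1 s0]; split.
    exact: (short_exact_iso a1 b1 c1 bi1 cp1 s1).
  exact: (short_exact_iso a0 b0 c0 bi0 cp0 s0).
- by move=> X; apply/mf_inflationP; split; apply: adm_mono_id.
- by move=> X; apply/mf_deflationP; split; apply: adm_epi_id.
- move=> X Y Z i j /mf_inflationP[i1 i0] /mf_inflationP[j1 j0].
  by apply/mf_inflationP; split; apply: adm_mono_comp.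
- move=> X Y Z i j /mf_deflationP[i1 i0] /mf_deflationP[j1 j0].
  by apply/mf_deflationP; split; apply: adm_epi_comp.
- move=> X Y X' i f /mf_inflationP[i1 i0].
  (* The pushout is built as the cokernel of (f, -i) from X to the sum of X' and Y. *)
  have ni1 := adm_mono_opp i1; have ni0 := adm_mono_opp i0.
  have /mf_inflationP[Q [q jq]] :
      adm_mono (mfc1 (mf_pair f (- i))) /\ adm_mono (mfc0 (mf_pair f (- i))).
    by split; apply: adm_mono_pair => //; [apply: mf1_gp | apply: mf0_gp].
  have jfi : mf_pair f (- i) = mf_inl X' Y \oc f - mf_inr X' Y \oc i.
    by rewrite mf_pairE compmN.
  have [j0' univ] := mf_is_cokernel jq.
  exists Q, (q \oc mf_inl X' Y), (q \oc mf_inr X' Y); split; last first.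
    by case: jq => s1 s0; apply/mf_inflationP; split;
      [apply: (pushout_adm_mono ni1 s1) | apply: (pushout_adm_mono ni0 s0)].
  split.
    by apply/eqP; rewrite eq_sym -subr_eq0 -!compA -compmB -jfi j0'.
  move=> W g g' e; have [|h [eh uh]] := univ W (mf_copair g' g).
    by rewrite jfi compmB !compA mf_copair_inl mf_copair_inr e subrr.
  exists h; split; first by rewrite !compA eh mf_copair_inl mf_copair_inr.
  move=> h' [e1 e2]; apply: uh; apply: mf_sum_ext; rewrite -compA ?e1 ?e2.
    by rewrite mf_copair_inl.
  by rewrite mf_copair_inr.
- move=> Y Z Z' p f /mf_deflationP[p1 p0].
  (* Dually, the pullback is the kernel of (p, -f) on the sum of Y and Z'. *)
  have /mf_deflationP[K [k kp]] :
      adm_epi (mfc1 (mf_copair p (- f))) /\ adm_epi (mfc0 (mf_copair p (- f))).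
    by split; apply: adm_epi_copair => //; [apply: mf1_gp | apply: mf0_gp].
  have pfE : mf_copair p (- f) = p \oc mf_fst Y Z' - f \oc mf_snd Y Z'.
    by apply: mf_ext => x; rewrite /= addr0 add0r.
  have [k0' univ] := mf_is_kernel kp.
  have E1 : mfc1 (mf_snd Y Z' \oc k) = snd \o mfc1 k :> {linear _ -> _}.
    by apply: linear_ext => x; rewrite /= add0r.
  have E0 : mfc0 (mf_snd Y Z' \oc k) = snd \o mfc0 k :> {linear _ -> _}.
    by apply: linear_ext => x; rewrite /= add0r.
  exists K, (mf_snd Y Z' \oc k), (mf_fst Y Z' \oc k); split; last first.
    case: kp => s1 s0; apply/mf_deflationP; rewrite E1 E0; split.
      exact: pullback_adm_epi p1 s1.
    exact: pullback_adm_epi p0 s0.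
  split; first by apply/eqP; rewrite -subr_eq0 !compA -compBm -pfE k0'.
  move=> W g g' e.
  have [|h [eh uh]] := univ W (mf_pair g g').
    by rewrite pfE compBm -!compA mf_fst_pair mf_snd_pair e subrr.
  exists h; split; first by rewrite -!compA eh mf_fst_pair mf_snd_pair.
  move=> h' [e1 e2]; apply: uh; rewrite mf_pairE -e1 -e2.
  by rewrite !compA -!compDm mf_sum_id comp1m.
Qed.

End MatrixFactorizations.

(** * Free matrix factorizations as projective and injective objects *)

Section MFFrobenius.
Variables (S : comNzRingType) (w : S).
Implicit Types X Y Z : MF w.

(* The factorization (1, w) of S^n plus the factorization (w, 1) of S^m. *)
Definition mf_free (n m : nat) : MF w.
Proof.
refine (@MFObject S w ('rV[S]_n * 'rV[S]_m)%type ('rV[S]_n * 'rV[S]_m)%type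
  (lpair fst (w \*: snd)) (lpair (w \*: fst) snd)
  (gp_prod (gp_row S n) (gp_row S m)) (gp_prod (gp_row S n) (gp_row S m)) _ _);
by case.
Defined.

Definition mf_of_free n m X (a : {linear 'rV[S]_n -> mf1 X})
  (b : {linear 'rV[S]_m -> mf0 X}) : hom (mf_free n m) X.
Proof.
refine (@mf_hom_of S w (mf_free n m) X
  (lcopair a (mf_map0 X \o b : {linear _ -> _}))
  (lcopair (mf_map1 X \o a : {linear _ -> _}) b) _ _) => -[x y].
  by rewrite /= linearD mf_map10 linearZ.
by rewrite /= linearD mf_map01 linearZ.
Defined.

(** On the summand (1, w) the first structure map is the identity, which forces the second component
    from the first; on (w, 1) the roles are exchanged. A morphism is thus determined by its
    restrictions to S^n in one component and S^m in the other. *)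
Lemma mf_of_freeE n m X (g : hom (mf_free n m) X) :
  g = mf_of_free (mfc1 g \o lpair idfun \0 : {linear _ -> _})
                 (mfc0 g \o lpair \0 idfun : {linear _ -> _}).
Proof.
apply: mf_ext => -[x y].
  rewrite /= (mf_comm0 g) -linearD /=; congr (mfc1 g (_, _)).
    by rewrite /= scaler0 addr0.
  by rewrite /= add0r.
rewrite /= (mf_comm1 g) -linearD /=; congr (mfc0 g (_, _)).
  by rewrite /= addr0.
by rewrite /= scaler0 add0r.
Qed.

Definition mf_to_free n m X (a : {linear mf0 X -> 'rV[S]_n})
  (b : {linear mf1 X -> 'rV[S]_m}) : hom X (mf_free n m).
Proof.
refine (@mf_hom_of S w X (mf_free n m)
  (lpair (a \o mf_map1 X : {linear _ -> _}) b)
  (lpair a (b \o mf_map0 X : {linear _ -> _})) _ _) => x.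
  by rewrite /= /pair_fun /= mf_map01 linearZ.
by rewrite /= /pair_fun /= mf_map10 linearZ.
Defined.

Lemma mf_to_freeE n m X (g : hom X (mf_free n m)) :
  g = mf_to_free (fst \o mfc0 g : {linear _ -> _})
                 (snd \o mfc1 g : {linear _ -> _}).
Proof.
apply: mf_ext => x; rewrite [LHS]surjective_pairing; congr (_, _) => /=.
  by rewrite -mf_comm1.
by rewrite -mf_comm0.
Qed.

Lemma mf_free_projective n m : projective_object (E := MF w) (mf_free n m).
Proof.
move=> X Y p g /mf_deflationP[[K1 [i1 [[_ _ s1] _]]] [K0 [i0 [[_ _ s0] _]]]].
have [a ea] := row_projective (mfc1 g \o lpair idfun \0 : {linear _ -> _}) s1.
have [b eb] := row_projective (mfc0 g \o lpair \0 idfun : {linear _ -> _}) s0.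
exists (mf_of_free a b); rewrite [RHS]mf_of_freeE.
by apply: mf_ext => -[x y]; rewrite /= linearD -?mf_comm1 -?mf_comm0 ea eb.
Qed.

(** A morphism to [mf_free] amounts to row-valued maps on the two components; these extend along an
    inflation because its cokernels have vanishing Ext^1 into S. *)
Lemma mf_free_injective n m : injective_object (E := MF w) (mf_free n m).
Proof.
move=> X Y i g /mf_inflationP[[C1 [p1 [s1 g1]]] [C0 [p0 [s0 g0]]]].
have [a ea] := extendable_row (gp_extendable s0 g0)
  (fst \o mfc0 g : {linear _ -> _}).
have [b eb] := extendable_row (gp_extendable s1 g1)
  (snd \o mfc1 g : {linear _ -> _}).
exists (mf_to_free a b); rewrite [RHS]mf_to_freeE.
apply: mf_ext => x; congr (_, _); rewrite /= ?mf_comm1 ?mf_comm0.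
- exact: ea.
- exact: eb.
- exact: ea.
- exact: eb.
Qed.

Hypothesis S_noetherian : noetherian S.

Lemma mf_free_cover X : exists n m K (i : hom K (mf_free n m)) p,
  conflation (c := MF w) (Z := X) i p.
Proof.
have [n [K1 [i1 [p1 [s1 g1]]]]] := gp_cover S_noetherian (mf1_gp X).
have [m [K0 [i0 [p0 [s0 g0]]]]] := gp_cover S_noetherian (mf0_gp X).
have /mf_deflationP[K [i ip]] :
    adm_epi (mfc1 (mf_of_free p1 p0)) /\ adm_epi (mfc0 (mf_of_free p1 p0)).
  split; first by apply: adm_epi_copair; [exists K1, i1 | apply: gp_row].
  by apply: adm_epi_copair_swap; [exists K0, i0 | apply: gp_row].
by exists n, m, K, i, (mf_of_free p1 p0).
Qed.

Lemma mf_free_hull X : exists n m C i (p : hom (mf_free n m) C),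
  conflation (c := MF w) (X := X) i p.
Proof.
have [n [C0 [i0 [p0 [s0 g0]]]]] := gp_embed S_noetherian (mf0_gp X).
have [m [C1 [i1 [p1 [s1 g1]]]]] := gp_embed S_noetherian (mf1_gp X).
have /mf_inflationP[C [p ip]] :
    adm_mono (mfc1 (mf_to_free i0 i1)) /\ adm_mono (mfc0 (mf_to_free i0 i1)).
  split; first by apply: adm_mono_pair; [exists C1, p1 | apply: gp_row].
  by apply: adm_mono_pair_swap; [exists C0, p0 | apply: gp_row].
by exists n, m, C, (mf_to_free i0 i1), p.
Qed.

Lemma MF_is_frobenius : is_frobenius (MF w).
Proof.
split=> [|X|X|X]; first exact: mf_exact.
- have [n [m [K [i [p ip]]]]] := mf_free_cover X.
  by split; apply: ProjPresentation (@mf_free_projective n m) ip.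
- have [n [m [C [i [p ip]]]]] := mf_free_hull X.
  by split; apply: InjCopresentation (@mf_free_injective n m) ip.
split=> [PX|IX].
  (* A projective object splits its free cover and is thus a retract of an object that is also
     injective; the converse splits the free hull. *)
  have [n [m [K [i [p ip]]]]] := mf_free_cover X.
  have [|s es] := PX _ _ p (idm X); first by exists K, i.
  exact: injective_object_retract es (@mf_free_injective n m).
have [n [m [C [i [p ip]]]]] := mf_free_hull X.
have [|r er] := IX _ _ i (idm X); first by exists C, p.
exact: projective_object_retract er (@mf_free_projective n m).
Qed.

End MFFrobenius.

(** * Transfer along an exact equivalence *)

Section AdditiveFunctors.
Variables (C D : preadditive) (F : additive_functor C D).

Lemma fhom0 (X Y : C) : fhom F (0 : hom X Y) = 0.
Proof. by apply: (addIr (fhom F 0)); rewrite -fhomD !add0r. Qed.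

Lemma fhomN (X Y : C) (f : hom X Y) : fhom F (- f) = - fhom F f.
Proof. by apply: (addIr (fhom F f)); rewrite -fhomD !addNr fhom0. Qed.

Lemma fhomB (X Y : C) (f g : hom X Y) : fhom F (f - g) = fhom F f - fhom F g.
Proof. by rewrite fhomD fhomN. Qed.

Lemma fhom_iso (X Y : C) (f : hom X Y) : is_iso f -> is_iso (fhom F f).
Proof.
by move=> [g [gf fg]]; exists (fhom F g); rewrite -!fhom_comp gf fg !fhom_id.
Qed.

Lemma equivalence_of_fully_faithful :
    (forall (X Y : C) (g : hom (F X) (F Y)), exists f, fhom F f = g) ->
    (forall (X Y : C) (f g : hom X Y), fhom F f = fhom F g -> f = g) ->
    (forall Y : D, exists (X : C) (e : hom (F X) Y), is_iso e) ->
  is_equivalence F.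
Proof.
move=> full faithful ess.
have [G0 eG0] := choice ess.
pose e Y := sval (cid (eG0 Y)).
have ee Y : is_iso (e Y) := svalP (cid (eG0 Y)).
pose e' Y := sval (cid (ee Y)).
have eK Y : e' Y \oc e Y = idm _ := (svalP (cid (ee Y))).1.
have e'K Y : e Y \oc e' Y = idm _ := (svalP (cid (ee Y))).2.
pose G1 (Y Y' : D) (g : hom Y Y') : hom (G0 Y) (G0 Y') :=
  sval (cid (full _ _ (e' Y' \oc g \oc e Y))).
have FG1 (Y Y' : D) (g : hom Y Y') : fhom F (G1 _ _ g) = e' Y' \oc g \oc e Y.
  exact: (svalP (cid (full _ _ (e' Y' \oc g \oc e Y)))).
have G1id Y : G1 Y Y (idm Y) = idm (G0 Y).
  by apply: faithful; rewrite FG1 fhom_id compm1 eK.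
have G1comp X Y Z (g : hom Y Z) (f : hom X Y) :
    G1 _ _ (g \oc f) = G1 _ _ g \oc G1 _ _ f.
  apply: faithful; rewrite fhom_comp !FG1 -!compA; congr (_ \oc (_ \oc _)).
  by rewrite compA e'K comp1m.
have G1D X Y (f g : hom X Y) : G1 _ _ (f + g) = G1 _ _ f + G1 _ _ g.
  by apply: faithful; rewrite fhomD !FG1 compmD compDm.
pose G := AdditiveFunctor G1id G1comp G1D.
exists G; split; last first.
  exists e; split=> [Y|X Y f]; first exact: ee.
  by rewrite /= FG1 !compA e'K comp1m.
pose eta X := sval (cid (full _ _ (e (F X)))).
have Feta X : fhom F (eta X) = e (F X) := svalP (cid (full _ _ (e (F X)))).
exists eta; split=> [X|X Y f].
  have [h eh] := full _ _ (e' (F X)); exists h.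
  by split; apply: faithful; rewrite fhom_comp fhom_id eh Feta ?eK ?e'K.
by apply: faithful; rewrite !fhom_comp FG1 !Feta !compA e'K comp1m.
Qed.
End AdditiveFunctors.

Section Transfer.
Variables (E E' : conflation_category) (F : additive_functor E E').
Hypothesis F_surj : forall Y : E', exists X : E, F X = Y.
Hypothesis F_bij : forall X Y : E, bijective (fun f : hom X Y => fhom F f).
Hypothesis F_conf : forall (X Y Z : E) (i : hom X Y) (p : hom Y Z),
  conflation i p <-> conflation (fhom F i) (fhom F p).

Lemma fhom_inj (X Y : E) : injective (fun f : hom X Y => fhom F f).
Proof. exact: bij_inj. Qed.

Lemma fhom_surj (X Y : E) (g : hom (F X) (F Y)) : exists f, fhom F f = g.
Proof. by have [h _ hK] := F_bij X Y; exists (h g). Qed.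

Lemma F_all_ob (P : E' -> Prop) : (forall X, P (F X)) -> forall Y, P Y.
Proof. by move=> PF Y; have [X <-] := F_surj Y. Qed.

(** Together with [F_ex_hom] this pulls existential data in E' back to E one quantifier at a time,
    without transport along isomorphisms. *)
Lemma F_ex_ob (P : E' -> Prop) : (exists Y, P Y) -> exists X, P (F X).
Proof. by move=> [Y]; have [X <-] := F_surj Y; exists X. Qed.

Lemma F_ex_hom X Y (P : hom (F X) (F Y) -> Prop) :
  (exists g, P g) -> exists f, P (fhom F f).
Proof. by move=> [g]; have [f <-] := fhom_surj g; exists f. Qed.

Lemma F_isoP (X Y : E) (f : hom X Y) : is_iso f <-> is_iso (fhom F f).
Proof.
split=> [|/F_ex_hom[g [gf fg]]]; first exact: fhom_iso.
by exists g; split; apply: fhom_inj; rewrite /= fhom_comp fhom_id.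
Qed.

Lemma F_inflationP (X Y : E) (i : hom X Y) : inflation i <-> inflation (fhom F i).
Proof.
split=> [[Z [p /F_conf]]|]; first by exists (F Z), (fhom F p).
by move=> /F_ex_ob[Z /F_ex_hom[p /F_conf ip]]; exists Z, p.
Qed.

Lemma F_deflationP (Y Z : E) (p : hom Y Z) : deflation p <-> deflation (fhom F p).
Proof.
split=> [[X [i /F_conf]]|]; first by exists (F X), (fhom F i).
by move=> /F_ex_ob[X /F_ex_hom[i /F_conf ip]]; exists X, i.
Qed.

Lemma F_unique (X Y : E) (P : hom X Y -> Prop) (P' : hom (F X) (F Y) -> Prop) :
  (forall f, P f <-> P' (fhom F f)) -> (exists! g, P' g) -> exists! f, P f.
Proof.
move=> PP' /F_ex_hom[f [Pf uf]]; exists f; split; first exact/PP'.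
by move=> f' /PP' Pf'; apply/fhom_inj/uf.
Qed.

Lemma fhom_eq (X Y : E) (f g : hom X Y) : f = g <-> fhom F f = fhom F g.
Proof. by split=> [->|/fhom_inj]. Qed.

Lemma F_projectiveP (P : E) : projective_object P <-> projective_object (F P).
Proof.
split=> [PP|PP X Y p g /F_deflationP dp].
  apply: F_all_ob => X; apply: F_all_ob => Y p g.
  have [p' <-] := fhom_surj p; have [g' <-] := fhom_surj g => /F_deflationP dp.
  by have [h <-] := PP _ _ p' g' dp; exists (fhom F h); rewrite fhom_comp.
have /F_ex_hom[h eh] := PP _ _ _ (fhom F g) dp.
by exists h; apply: fhom_inj; rewrite /= fhom_comp.
Qed.

Lemma F_injectiveP (I : E) : injective_object I <-> injective_object (F I).
Proof.
split=> [II|II X Y i g /F_inflationP di].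
  apply: F_all_ob => X; apply: F_all_ob => Y i g.
  have [i' <-] := fhom_surj i; have [g' <-] := fhom_surj g => /F_inflationP di.
  by have [h <-] := II _ _ i' g' di; exists (fhom F h); rewrite fhom_comp.
have /F_ex_hom[h eh] := II _ _ _ (fhom F g) di.
by exists h; apply: fhom_inj; rewrite /= fhom_comp.
Qed.

Lemma is_exact_transfer : is_exact E' -> is_exact E.
Proof.
move=> exE; split.
- have /F_ex_ob[Z Z0] := exact_zero exE.
  by exists Z; apply: fhom_inj; rewrite /= fhom0 fhom_id.
- move=> X Y.
  have /F_ex_ob[B /F_ex_hom[i1 /F_ex_hom[i2 /F_ex_hom[p1 /F_ex_hom[p2]]]]] :=
    exact_biproducts exE (F X) (F Y).
  case=> e1 e2 e3 e4 e5; exists B, i1, i2, p1, p2.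
  by split; apply: fhom_inj; rewrite /= ?fhomD ?fhom_comp ?fhom_id ?fhom0.
- move=> X Y Z i p /F_conf/(exact_ker exE)[pi0 univ]; split.
    by apply: fhom_inj; rewrite /= fhom_comp fhom0.
  move=> W g; rewrite fhom_eq fhom_comp fhom0 => /univ.
  by apply: F_unique => f; rewrite fhom_eq fhom_comp.
- move=> X Y Z i p /F_conf/(exact_coker exE)[pi0 univ]; split.
    by apply: fhom_inj; rewrite /= fhom_comp fhom0.
  move=> W g; rewrite fhom_eq fhom_comp fhom0 => /univ.
  by apply: F_unique => f; rewrite fhom_eq fhom_comp.
- move=> X Y Z X' Y' Z' i p i' p' a b c /F_isoP ia /F_isoP ib /F_isoP ic.
  rewrite !fhom_eq !fhom_comp => e e' /F_conf ip; apply/F_conf.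
  exact: (exact_iso exE ia ib ic e e' ip).
- by move=> X; apply/F_inflationP; rewrite fhom_id; apply: exact_id_inflation.
- by move=> X; apply/F_deflationP; rewrite fhom_id; apply: exact_id_deflation.
- move=> X Y Z i j /F_inflationP ii /F_inflationP ij.
  by apply/F_inflationP; rewrite fhom_comp; apply: exact_comp_inflation.
- move=> X Y Z i j /F_deflationP ii /F_deflationP ij.
  by apply/F_deflationP; rewrite fhom_comp; apply: exact_comp_deflation.
- move=> X Y X' i f /F_inflationP /(exact_pushout exE (fhom F f)).
  move=> /F_ex_ob[Y' /F_ex_hom[i' /F_ex_hom[f' [[e univ] /F_inflationP ii']]]].
  exists Y', i', f'; split=> //; split; first by apply/fhom_eq; rewrite !fhom_comp.
  move=> W g g'; rewrite fhom_eq !fhom_comp => /univ.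
  by apply: F_unique => h; rewrite !fhom_eq !fhom_comp.
- move=> Y Z Z' p f /F_deflationP /(exact_pullback exE (fhom F f)).
  move=> /F_ex_ob[Y' /F_ex_hom[p' /F_ex_hom[f' [[e univ] /F_deflationP dp']]]].
  exists Y', p', f'; split=> //; split; first by apply/fhom_eq; rewrite !fhom_comp.
  move=> W g g'; rewrite fhom_eq !fhom_comp => /univ.
  by apply: F_unique => h; rewrite !fhom_eq !fhom_comp.
Qed.

Lemma is_frobenius_transfer : is_frobenius E' -> is_frobenius E.
Proof.
case=> exE ep ei pi; split=> [|X|X|X]; first exact: is_exact_transfer.
- have [[P K i p PP ip]] := ep (F X).
  have : exists P K (i : hom K P) (p : hom P (F X)),
      projective_object P /\ conflation i p.
    by exists P, K, i, p.
  move=> /F_ex_ob[Q /F_ex_ob[L /F_ex_hom[j /F_ex_hom[q]]]].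
  move=> [/F_projectiveP PQ /F_conf jq].
  by split; apply: ProjPresentation PQ jq.
- have [[I C i p II ip]] := ei (F X).
  have : exists I C (i : hom (F X) I) (p : hom I C),
      injective_object I /\ conflation i p.
    by exists I, C, i, p.
  move=> /F_ex_ob[Q /F_ex_ob[L /F_ex_hom[j /F_ex_hom[q]]]].
  move=> [/F_injectiveP IQ /F_conf jq].
  by split; apply: InjCopresentation IQ jq.
by rewrite F_projectiveP F_injectiveP.
Qed.

End Transfer.

(** * Stable categories *)

Section ConflationLift.
Variable E : frobenius_category.

(** The relation [cosyzygy_lift] for arbitrary conflations: a functor sends the chosen
    copresentation of X to a conflation that need not be the one chosen for F X. *)
Definition conflation_lift (X J C X' J' C' : E) (i : hom X J) (p : hom J C)
    (i' : hom X' J') (p' : hom J' C') (f : hom X X') (c : hom C C') : Prop :=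
  exists b : hom J J', b \oc i = i' \oc f /\ c \oc p = p' \oc b.

Lemma conflation_lift_exists (X J C X' J' C' : E) (i : hom X J) (p : hom J C)
    (i' : hom X' J') (p' : hom J' C') (f : hom X X') :
    conflation i p -> conflation i' p' -> injective_object J' ->
  exists c, conflation_lift i p i' p' f c.
Proof.
move=> ip ip' IJ'; have exE := frob_exact (frobP E).
have [|b eb] := IJ' _ _ i (i' \oc f); first by exists C, p.
have [_ univ] := exact_coker exE ip; have [p0 _] := exact_coker exE ip'.
have [|c [ec _]] := univ _ (p' \oc b).
  by rewrite -compA eb compA p0 comp0m.
by exists c, b.
Qed.

Lemma conflation_lift_unique (X J C X' J' C' : E) (i : hom X J) (p : hom J C)
    (i' : hom X' J') (p' : hom J' C') (f f' : hom X X') (c c' : hom C C') :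
    conflation i p -> conflation i' p' -> injective_object J' ->
    conflation_lift i p i' p' f c -> conflation_lift i p i' p' f' c' ->
  stab f = stab f' -> stab c = stab c'.
Proof.
move=> ip ip' IJ' [b [eb ec]] [b' [eb' ec']].
move=> /stab_eq/stably_zeroP[P [PP [u [v euv]]]].
have [exE _ _ PI] := frobP E.
have [|u' eu] := (PI P).1 PP _ _ i u; first by exists C, p.
have [_ univ] := exact_coker exE ip; have [p0 _] := exact_coker exE ip'.
(* The correction by i' v u' makes the difference of the middle maps vanish on X, so it factors as h
   p; since p' i' = 0, the difference c - c' is p' h and factors through J'. *)
have [|h [eh _]] := univ _ (b - b' - i' \oc v \oc u').
  by rewrite !compBm eb eb' -compmB euv -!compA eu subrr.
apply/stab_eq/stably_zeroP; exists J'; split; first exact/PI.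
exists h, p'; apply: (conflation_epi ip).
by rewrite -compA eh compBm ec ec' !compmB !compA p0 !comp0m subr0.
Qed.

Lemma conflation_lift_id (X J C : E) (i : hom X J) (p : hom J C) :
  conflation_lift i p i p (idm X) (idm C).
Proof. by exists (idm J); rewrite !comp1m !compm1. Qed.

Lemma conflation_lift_comp (X J C X' J' C' X'' J'' C'' : E)
    (i : hom X J) (p : hom J C) (i' : hom X' J') (p' : hom J' C')
    (i'' : hom X'' J'') (p'' : hom J'' C'')
    (f : hom X X') (c : hom C C') (f' : hom X' X'') (c' : hom C' C'') :
  conflation_lift i p i' p' f c -> conflation_lift i' p' i'' p'' f' c' ->
  conflation_lift i p i'' p'' (f' \oc f) (c' \oc c).
Proof.
move=> [b [eb ec]] [b' [eb' ec']]; exists (b' \oc b); split.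
  by rewrite -compA eb !compA eb'.
by rewrite -compA ec !compA ec'.
Qed.

(** The cosyzygies of one object computed from two injective copresentations are stably isomorphic:
    lifts of the identity in both directions compose to lifts of the identity, which are stably
    unique. *)
Lemma conflation_lift_id_iso (X J C J' C' : E) (i : hom X J) (p : hom J C)
    (i' : hom X J') (p' : hom J' C') (c : hom C C') :
    conflation i p -> conflation i' p' ->
    injective_object J -> injective_object J' ->
    conflation_lift i p i' p' (idm X) c ->
  is_iso (stab c : @hom (stable_category E) C C').
Proof.
move=> ip ip' IJ IJ' lc.
have [c' lc'] := conflation_lift_exists (idm X) ip' ip IJ.
have l := conflation_lift_comp lc lc'; have l' := conflation_lift_comp lc' lc.
rewrite comp1m in l l'; exists (stab c'); rewrite /= !stab_comp; split.
  exact: (conflation_lift_unique ip ip IJ l (conflation_lift_id i p) erefl).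
exact: (conflation_lift_unique ip' ip' IJ' l' (conflation_lift_id i' p') erefl).
Qed.

End ConflationLift.

Section StableFunctor.
Variables (E E' : frobenius_category) (F : additive_functor E E').
Hypothesis F_conf : forall (X Y Z : E) (i : hom X Y) (p : hom Y Z),
  conflation i p -> conflation (fhom F i) (fhom F p).
Hypothesis F_proj : forall P : E, projective_object P -> projective_object (F P).

Definition stable_map (X Y : stable_category E) (f : hom X Y) :
    @hom (stable_category E') (F X) (F Y) :=
  stab (fhom F (stab_repr f)).

Lemma stable_mapE (X Y : E) (f : hom X Y) : stable_map (stab f) = stab (fhom F f).
Proof.
apply/stab_eq; rewrite -fhomB.
have /stab_eq/stably_zeroP[P [PP [u [v ->]]]] := stab_reprK (stab f).
apply/stably_zeroP; exists (F P); split; first exact: F_proj.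
by exists (fhom F u), (fhom F v); rewrite fhom_comp.
Qed.

Fact stable_map_id (X : stable_category E) :
  stable_map (idm X) = idm (F X : stable_category E').
Proof. by rewrite stable_mapE fhom_id. Qed.

Fact stable_map_comp (X Y Z : stable_category E) (g : hom Y Z) (f : hom X Y) :
  stable_map (g \oc f) = stable_map g \oc stable_map f.
Proof.
have [g' ->] := stab_ind g; have [f' ->] := stab_ind f.
by rewrite /= stab_comp !stable_mapE fhom_comp stab_comp.
Qed.

Fact stable_mapD (X Y : stable_category E) (f g : hom X Y) :
  stable_map (f + g) = stable_map f + stable_map g.
Proof.
have [g' ->] := stab_ind g; have [f' ->] := stab_ind f.
by rewrite -stabD !stable_mapE fhomD stabD.
Qed.

Definition stable_functor :
    additive_functor (stable_category E) (stable_category E') :=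
  AdditiveFunctor stable_map_id stable_map_comp stable_mapD.

Lemma F_inj (I : E) : injective_object I -> injective_object (F I).
Proof.
have [_ _ _ PI] := frobP E; have [_ _ _ PI'] := frobP E'.
by move=> /PI/F_proj/PI'.
Qed.

Local Notation F_copres_conf X := (F_conf (ih_conf (copres X))).

Lemma shift_comparison_exists (X : E) :
  exists c : hom (F (cosyzygy X)) (cosyzygy (F X)),
  conflation_lift (fhom F (ih_map (copres X))) (fhom F (ih_proj (copres X)))
    (ih_map (copres (F X))) (ih_proj (copres (F X))) (idm (F X)) c.
Proof.
exact: conflation_lift_exists (F_copres_conf X) (ih_conf _) (@ih_injP _ _ _).
Qed.

Definition shift_comparison (X : E) : hom (F (cosyzygy X)) (cosyzygy (F X)) :=
  sval (cid (shift_comparison_exists X)).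

Definition stable_shift (X : stable_triangulated E) :
    hom (stable_functor (shift _ X))
        (shift (stable_triangulated E') (stable_functor X)) :=
  stab (shift_comparison X).

Lemma stable_shift_natural_iso :
  @natural_iso (stable_triangulated E) (stable_triangulated E')
    (comp_functor stable_functor (shift (stable_triangulated E)))
    (comp_functor (shift (stable_triangulated E')) stable_functor) stable_shift.
Proof.
split=> [X|X Y f].
  apply: (conflation_lift_id_iso (F_copres_conf X) (ih_conf _) _ _
    (svalP (cid (shift_comparison_exists X)))); last exact: ih_injP.
  exact/F_inj/ih_injP.
have [f' ->] := stab_ind f; have [c lc] := cosyzygy_lift_exists f'.
have [d ld] := cosyzygy_lift_exists (fhom F f').
rewrite /= (cosyzygy_mapE lc) !stable_mapE (cosyzygy_mapE ld).
rewrite /stable_shift !stab_comp.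
have sX := svalP (cid (shift_comparison_exists X)).
have sY := svalP (cid (shift_comparison_exists Y)).
have Flc : conflation_lift
    (fhom F (ih_map (copres X))) (fhom F (ih_proj (copres X)))
    (fhom F (ih_map (copres Y))) (fhom F (ih_proj (copres Y)))
    (fhom F f') (fhom F c).
  by case: lc => b [e1 e2]; exists (fhom F b); rewrite -!fhom_comp e1 e2.
(* Both ways around the naturality square lift the same morphism between the image of the
   copresentation of X and the copresentation of F Y, so they agree stably. *)
have l1 := conflation_lift_comp Flc sY; have l2 := conflation_lift_comp sX ld.
apply: (conflation_lift_unique (F_copres_conf X) (ih_conf _) _ l1 l2).
  exact: ih_injP.
by rewrite comp1m compm1.
Qed.

Lemma stable_functor_distinguished (X Y Z : stable_triangulated E)
    (u : hom X Y) (v : hom Y Z) (w : hom Z (shift _ X)) :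
  distinguished u v w ->
  @distinguished (stable_triangulated E') _ _ _
    (fhom stable_functor u) (fhom stable_functor v)
    (stable_shift X \oc fhom stable_functor w).
Proof.
have [_ nat] := stable_shift_natural_iso.
move=> [X' [Y' [Z' [u' [v' [w' [a [b [c [st ia ib ic [e1 e2 e3]]]]]]]]]]].
exists (F X'), (F Y'), (F Z'), (fhom stable_functor u'), (fhom stable_functor v'),
  (stable_shift X' \oc fhom stable_functor w'), (fhom stable_functor a),
  (fhom stable_functor b), (fhom stable_functor c).
split; try exact: fhom_iso.
- case: st => u0 [v0 [b0 [h [uv eb eh [-> -> ->]]]]].
  (* B maps the image of the injective hull of X' to the chosen hull of F X'; composing with it
     turns the image of the data of a standard triangle into such data in E'. *)
  have [B [eB eC]] := svalP (cid (shift_comparison_exists X')).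
  exists (fhom F u0), (fhom F v0), (B \oc fhom F b0),
    (shift_comparison X' \oc fhom F h).
  split; first exact: F_conf.
  + by rewrite -compA -fhom_comp eb eB compm1.
  + by rewrite -compA -fhom_comp eh fhom_comp !compA eC.
  split; try exact: stable_mapE.
  rewrite -stab_comp -stable_mapE.
  transitivity (stable_shift X' \oc
    - fhom stable_functor (stab h : @hom (stable_category E) _ _)).
    by congr (_ \oc _); apply: (@fhomN _ _ stable_functor _ _ (stab h)).
  exact: (@compmN (stable_category E')).
- split; first by rewrite -!fhom_comp e1.
    by rewrite -!fhom_comp e2.
  have na : stable_shift X' \oc
        fhom stable_functor (fhom (cosyzygy_functor E) a) =
      fhom (cosyzygy_functor E') (fhom stable_functor a) \oc
        stable_shift X := nat _ _ a.
  rewrite compA -na -!compA; congr (_ \oc _).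
  transitivity (fhom stable_functor (fhom (cosyzygy_functor E) a \oc w)).
    exact/esym/(fhom_comp stable_functor).
  by rewrite e3; apply: (fhom_comp stable_functor).
Qed.

Definition stable_triangle_functor :
    triangle_functor (stable_triangulated E) (stable_triangulated E') :=
  @TriangleFunctor (stable_triangulated E) (stable_triangulated E')
    stable_functor stable_shift stable_shift_natural_iso
    stable_functor_distinguished.

Lemma stable_functor_equivalence :
    (forall X Y : E, bijective (fun f : hom X Y => fhom F f)) ->
    (forall Y : E', exists X : E, F X = Y) ->
    (forall P : E, projective_object (F P) -> projective_object P) ->
  is_equivalence stable_functor.
Proof.
move=> bijF surjF projF; apply: equivalence_of_fully_faithful.
- move=> X Y g; have [g' ->] := stab_ind g.
  by have [f <-] := fhom_surj bijF g'; exists (stab f); rewrite -stable_mapE.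
- move=> X Y f g; have [f' ->] := stab_ind f; have [g' ->] := stab_ind g.
  rewrite /= !stable_mapE => /stab_eq; rewrite -fhomB => /stably_zeroP[P [PP]].
  (* Replacing P by F Q, both halves of the factorization lie in the image of F, so faithfulness
     moves the factorization back to E. *)
  have [Q eQ] := surjF P; case: P / eQ PP => /projF PQ [u [v]].
  have [u' <-] := fhom_surj bijF u; have [v' <-] := fhom_surj bijF v.
  rewrite -fhom_comp => /(fhom_inj bijF) e.
  by apply/stab_eq/stably_zeroP; exists Q; split=> //; exists u', v'.
- move=> Y; have [X <-] := surjF Y; exists X, (idm _).
  by exists (idm _); rewrite !comp1m.
Qed.

End StableFunctor.

(** * From monomorphisms to matrix factorizations *)

Section MonToMF.
Variables (S : comNzRingType) (w : S).

(** Multiplication by w on G_0 lands in the image of the injective map f, so it divides by f; the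
    quotient is the missing half g_0 of the factorization. *)
Lemma mon_division (X : Mon w) :
  exists g : {linear mon0 X -> mon1 X}, forall x, mon_map X (g x) = w *: x.
Proof.
exact: (lift_mono (f := (w \*: idfun : {linear mon0 X -> mon0 X}))
  (@mon_inj _ _ X) (@mon_coker _ _ X)).
Qed.

Definition mf_of_mon (X : Mon w) : MF w.
Proof.
refine (@MFObject S w (mon1 X) (mon0 X) (mon_map X) (sval (cid (mon_division X)))
  (mon1_gp X) (mon0_gp X) (svalP (cid (mon_division X))) _) => x.
by apply: (@mon_inj _ _ X); rewrite (svalP (cid (mon_division X))) linearZ.
Defined.

(** The square for the second structure maps becomes an instance of linearity after composing with
    the injective [mon_map Y]. *)
Fact mf_of_mon_hom_subproof (X Y : Mon w) (f : hom X Y) :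
  mon_hom_val (f : mon_hom X Y) \in @mf_commutes S w (mf_of_mon X) (mf_of_mon Y).
Proof.
have /asboolP e := mon_homP (f : mon_hom X Y); apply/asboolP; split=> // x.
apply: (@mon_inj _ _ Y); rewrite e !(svalP (cid (mon_division _))).
by rewrite linearZ.
Qed.
Definition mf_of_mon_hom (X Y : Mon w) (f : hom X Y) :
  hom (mf_of_mon X) (mf_of_mon Y) :=
  MFHom (mf_of_mon_hom_subproof f).

Definition mf_of_mon_functor : additive_functor (Mon w) (MF w).
Proof.
by apply: (@AdditiveFunctor (Mon w) (MF w) mf_of_mon mf_of_mon_hom) => *;
  apply: mf_hom_ext.
Defined.

Lemma mf_of_mon_bijective (X Y : Mon w) :
  bijective (fun f : hom X Y => fhom mf_of_mon_functor f).
Proof.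
have cm (g : hom (mf_of_mon X) (mf_of_mon Y)) :
    mf_hom_val (g : mf_hom _ _) \in @mon_commutes S w X Y.
  by have /asboolP[e _] := mf_homP (g : mf_hom _ _); apply/asboolP.
by exists (fun g => MonHom (cm g)) => f; [apply: mon_hom_ext | apply: mf_hom_ext].
Qed.

(** If g_1 x = 0 then w x = g_0 (g_1 x) = 0, so w kills every value of a linear form at x, and
    regularity of w makes these values zero. *)
Lemma mf_map1_inj (Y : MF w) : GRing.lreg w -> injective (mf_map1 Y).
Proof.
move=> rw; apply: inj_ker0 => x e; apply: (gp_torsionless (mf1_gp Y)) => phi.
apply: rw; rewrite mulr0 -[LHS]/(w *: _) -linearZ -[in LHS]mf_map01 e.
by rewrite !raddf0.
Qed.

(** Apart from the modules and maps, all fields are proofs, so proof irrelevance yields equality of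
    objects. This is what makes the functor surjective up to equality. *)
Lemma mf_object_eq (A B : lmodType S)
    (f : {linear A -> B}) (g g' : {linear B -> A})
    (gA gA' : gorenstein_projective A) (gB gB' : gorenstein_projective B)
    (e : forall x, f (g x) = w *: x) (e' : forall x, f (g' x) = w *: x)
    (d : forall x, g (f x) = w *: x) (d' : forall x, g' (f x) = w *: x) :
  g =1 g' -> MFObject gA gB e d = MFObject gA' gB' e' d'.
Proof.
move=> /linear_ext eg; case: g' / eg e' d' => e' d'.
by congr MFObject; apply: Prop_irrelevance.
Qed.

Lemma mf_of_mon_surj : GRing.lreg w ->
  forall Y : MF w, exists X : Mon w, mf_of_mon_functor X = Y.
Proof.
move=> rw Y; have iY := mf_map1_inj (Y := Y) rw.
have cY (x : mf0 Y) : exists y, mf_map1 Y y = w *: x.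
  by exists (mf_map0 Y x); apply: mf_map10.
exists (MonObject (mf1_gp Y) (mf0_gp Y) iY cY).
case: Y iY cY => A B f g gA gB e d iY cY; apply: mf_object_eq => x.
have := svalP (cid (mon_division (MonObject gA gB iY cY))) x.
by rewrite -[RHS]e => /iY.
Qed.

(** The functor leaves the underlying pairs of linear maps untouched, so the two propositions
    coincide by computation. *)
Lemma mf_of_mon_conflation (X Y Z : Mon w) (i : hom X Y) (p : hom Y Z) :
  conflation i p <->
  conflation (fhom mf_of_mon_functor i) (fhom mf_of_mon_functor p).
Proof. by []. Qed.

End MonToMF.

Theorem theorem3p9 (S : comNzRingType) (n : set S) (w : S)
    (S_noetherian : noetherian S) (S_local : local_with n)
    (w_in_n : n w) (w_regular : GRing.lreg w) :
  exists (Mon_frobenius : is_frobenius (Mon w))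
         (MF_frobenius : is_frobenius (MF w))
         (F : triangle_functor
                (stable_triangulated (FrobeniusCategory Mon_frobenius))
                (stable_triangulated (FrobeniusCategory MF_frobenius))),
    is_equivalence F.
Proof.
have surj := mf_of_mon_surj w_regular.
have bij := @mf_of_mon_bijective S w.
have conf := @mf_of_mon_conflation S w.
have MF_frob : is_frobenius (MF w) := MF_is_frobenius w S_noetherian.
have Mon_frob : is_frobenius (Mon w) :=
  is_frobenius_transfer surj bij conf MF_frob.
have proj := F_projectiveP surj bij conf.
pose MonF := FrobeniusCategory Mon_frob; pose MFF := FrobeniusCategory MF_frob.
have F_conf X Y Z i p := (conf X Y Z i p).1.
have F_proj P := (proj P).1.
exists Mon_frob, MF_frob, (@stable_triangle_functor MonF MFF _ F_conf F_proj).
exact: (@stable_functor_equivalence MonF MFF _ F_proj bij surj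
  (fun P => (proj P).2)).
Qed.
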